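(* Let $0<q<1$ and let $G=\bigoplus_{i=1}^r\mathbb{Z}/a_i\mathbb{Z}$ be a finite abelian group with $a_r\mid a_{r-1}\mid\cdots\mid a_1$ positive integers. For each $n$ let $\Gamma\in G(n,q)$ be an Erdős–Rényi random graph with sandpile group $S_\Gamma$. Then $$\lim_{n\to\infty}\mathbb{E}(\#\operatorname{Sur}(S_\Gamma,G))=\prod_{i=1}^r a_i^{\,i-1}.$$
   Context: $\operatorname{Sur}(A,B)$ is the set of surjective group homomorphisms $A\to B$. $G(n,q)$: random graph on the labeled vertex set $[n]=\{1,\dots,n\}$ in which each of the $\binom n2$ possible edges is present independently with probability $q$. Sandpile group: for a graph $\Gamma$ on $[n]$, the Laplacian $L_\Gamma$ is the $n\times n$ integer matrix with $(i,j)$ entry $1$ if $i\neq j$ and $\{i,j\}$ is an edge, $0$ if $i\ne j$ and $\{i,j\}$ is not an edge, and $-\deg(i)$ if $i=j$. Let $Z\subset\mathbb{Z}^n$ be the subgroup of vectors whose coordinates sum to $0$. The column space (image) of $L_\Gamma$ is contained in $Z$, and $S_\Gamma:=Z/L_\Gamma\mathbb{Z}^n$. This is a finitely generated abelian group, finite if and only if $\Gamma$ is connected. *)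

(* Defs.v *)
From HB Require Import structures.
From mathcomp Require Import all_boot all_order all_algebra finmap.
From mathcomp Require Import ring_quotient.
From mathcomp Require Import all_classical all_reals all_analysis.

Set Implicit Arguments.
Unset Strict Implicit.
Unset Printing Implicit Defensive.

Import Order.TTheory GRing.Theory Num.Theory.
Import numFieldNormedType.Exports.

Local Open Scope classical_set_scope.
Local Open Scope ring_scope.

Section Graphs.
Context {n : nat}.

Definition edge := {e : {set 'I_n} | #|e| == 2}.
HB.instance Definition _ := Finite.on edge.

Definition graph := {set edge}.
HB.instance Definition _ := Finite.on graph.

Definition adj (g : graph) (i j : 'I_n) : bool :=
  [exists e in g, val e == [set i; j]%SET].

Definition degree (g : graph) (i : 'I_n) : nat := #|[set j | adj g i j]%SET|.

Definition laplacian (g : graph) : 'M[int]_n :=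
  \matrix_(i, j) (if i == j then - (degree g i)%:Z else (adj g i j)%:Z).

End Graphs.
Arguments edge : clear implicits.
Arguments graph : clear implicits.

Lemma adj_sym n (g : graph n) i j : adj g i j = adj g j i.
Proof. by rewrite /adj finset.setUC. Qed.

Lemma adj_irrefl n (g : graph n) i : adj g i i = false.
Proof.
apply/negbTE/negP => /existsP[e /andP[_ /eqP ve]].
by have := valP e; rewrite ve cards2 eqxx.
Qed.

Section ErdosRenyi.
Context {R : realType} {n : nat}.

(* Law of G(n,q): each potential edge is kept independently with probability q,
   so the mass of a graph is the product of the Bernoulli(q) masses. *)
Definition gnq_prob (q : R) (g : graph n) : R :=
  \prod_(e : edge n) (if e \in g then q else 1 - q).

Definition gnq_expectation (q : R) (X : graph n -> R) : R :=
  \sum_(g : graph n) gnq_prob q g * X g.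

Lemma gnq_prob_sum1 (q : R) : \sum_(g : graph n) gnq_prob q g = 1.
Proof.
rewrite /gnq_prob -(@bigA_distr _ _ _ _ _ _ (fun=> q) (fun=> 1 - q)) big1// => e _.
by rewrite /= addrC subrK.
Qed.

End ErdosRenyi.

Section ZeroSum.
Context {n : nat}.

Definition zero_sum : {pred 'cV[int]_n} := fun v => \sum_i v i 0 == 0.

Lemma zero_sum_zmod_closed : zmod_closed zero_sum.
Proof.
split; rewrite ?unfold_in.
  by rewrite big1// => i _; rewrite mxE.
move=> u v; rewrite !unfold_in => /eqP u0 /eqP v0.
under eq_bigr do rewrite !mxE.
by rewrite sumrB u0 v0 subr0.
Qed.
HB.instance Definition _ :=
  GRing.isZmodClosed.Build 'cV[int]_n zero_sum zero_sum_zmod_closed.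

Definition zsum := {v : 'cV[int]_n | v \in zero_sum}.
HB.instance Definition _ := SubChoice.on zsum.
HB.instance Definition _ := [SubChoice_isSubZmodule of zsum by <:].

End ZeroSum.
Arguments zsum : clear implicits.

Section Sandpile.
Context {n : nat} (g : graph n).

Definition laplacian_image : {pred zsum n} :=
  fun z => `[< exists v : 'cV[int]_n, val z = laplacian g *m v >].

Lemma laplacian_image_zmod_closed : zmod_closed laplacian_image.
Proof.
split; rewrite ?unfold_in.
  by apply/asboolP; exists 0; rewrite mulmx0 raddf0.
move=> x y; rewrite !unfold_in => /asboolP[u xu] /asboolP[v yv].
by apply/asboolP; exists (u - v); rewrite raddfB/= xu yv mulmxBr.
Qed.
HB.instance Definition _ :=
  GRing.isZmodClosed.Build (zsum n) laplacian_image laplacian_image_zmod_closed.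

Lemma laplacian_zero_sum (v : 'cV[int]_n) : laplacian g *m v \in zero_sum.
Proof.
rewrite unfold_in; under eq_bigr do rewrite mxE.
rewrite exchange_big /= big1// => j _; rewrite -mulr_suml.
suff -> : \sum_i laplacian g i j = 0 by rewrite mul0r.
rewrite (bigD1 j)//= mxE eqxx.
under eq_bigr => i /negbTE ij do rewrite mxE ij adj_sym.
apply/eqP; rewrite addrC subr_eq0; apply/eqP.
transitivity (\sum_i (adj g j i)%:Z).
  by rewrite [RHS](bigD1 j)//= adj_irrefl add0r.
rewrite /degree -sum1_card [in RHS]big_mkcond/= -[RHS]natz natr_sum.
by apply: eq_bigr => i _; rewrite inE; case: (adj g j i).
Qed.

Definition sandpile : zmodType := Quotient.quot laplacian_image.

End Sandpile.

(* The library's 'Z_m denotes Z/2 when m = 1, hence this variant, which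
   is Z/m for every m > 0. *)
Definition Zmod (m : nat) : finZmodType := 'I_m.-1.+1.

(* Direct sum of the Zmod (a i). *)
Section DirectSum.
Context {r : nat} (a : 'I_r -> nat).

Definition Zmod_sum := {dffun forall i : 'I_r, Zmod (a i)}.
HB.instance Definition _ := Finite.on Zmod_sum.

Definition Zmod_sum_zero : Zmod_sum := [ffun i => 0 : Zmod (a i)].
Definition Zmod_sum_opp (x : Zmod_sum) : Zmod_sum :=
  [ffun i => - x i : Zmod (a i)].
Definition Zmod_sum_add (x y : Zmod_sum) : Zmod_sum :=
  [ffun i => x i + y i : Zmod (a i)].

Lemma Zmod_sum_addA : associative Zmod_sum_add.
Proof. by move=> x y z; apply/ffunP => i; rewrite !ffunE addrA. Qed.
Lemma Zmod_sum_addC : commutative Zmod_sum_add.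
Proof. by move=> x y; apply/ffunP => i; rewrite !ffunE addrC. Qed.
Lemma Zmod_sum_add0 : left_id Zmod_sum_zero Zmod_sum_add.
Proof. by move=> x; apply/ffunP => i; rewrite !ffunE add0r. Qed.
Lemma Zmod_sum_addN : left_inverse Zmod_sum_zero Zmod_sum_opp Zmod_sum_add.
Proof. by move=> x; apply/ffunP => i; rewrite !ffunE addNr. Qed.
HB.instance Definition _ := GRing.isZmodule.Build Zmod_sum
  Zmod_sum_addA Zmod_sum_addC Zmod_sum_add0 Zmod_sum_addN.

End DirectSum.

Definition Sur (A B : zmodType) : set (A -> B) :=
  [set f | zmod_morphism f /\ range f = [set: B]].
Arguments Sur : clear implicits.

(* fset_set returns the empty set on infinite sets; finite_Sur_sandpile below
   shows that this does not happen in the case of interest. *)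
Definition num_Sur (A B : zmodType) : nat := #|` fset_set (Sur A B)|.

Lemma zmod_morphism_cV n (B : zmodType) (F : 'cV[int]_n -> B) (v : 'cV[int]_n) :
  zmod_morphism F -> F v = \sum_i F (delta_mx i 0) *~ v i 0.
Proof.
move=> FB.
pose Fa : {additive 'cV[int]_n -> B} :=
  HB.pack F (GRing.isZmodMorphism.Build _ _ F FB).
have FaE : Fa =1 F by [].
rewrite -FaE [in LHS](matrix_sum_delta v) raddf_sum; apply: eq_bigr => i _.
by rewrite big_ord1 -FaE -raddfMz -scaler_int intz.
Qed.

Lemma finite_Sur_sandpile n (g : graph n) r (a : 'I_r -> nat) :
  finite_set (Sur (sandpile g) (Zmod_sum a)).
Proof.
case: n g => [|n] g.
  have sp0 (x y : sandpile g) : x = y.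
    rewrite -[x]reprK -[y]reprK; congr (\pi_(_)%qT _).
    by apply/val_inj/matrixP => -[].
  apply: (@sub_finite_set _ _ (range (fun b : Zmod_sum a => fun=> b))).
    by move=> f _; exists (f 0) => //; apply/funext => x; congr f; exact: sp0.
  exact/finite_image/finite_finset.
(* v |-> v - (sum v) e_0 is a retraction of Z^n onto its zero-sum subgroup *)
pose p (v : 'cV[int]_n.+1) : 'cV[int]_n.+1 :=
  v - (\sum_i v i 0) *: delta_mx 0 0.
have pz v : p v \in zero_sum.
  rewrite unfold_in /p; under eq_bigr do rewrite !mxE.
  rewrite sumrB subr_eq0; apply/eqP.
  rewrite [RHS](bigD1 ord0)//= mulr1 [X in _ + X]big1 ?addr0// => i /negbTE ->.
  by rewrite mulr0.
pose Q v : zsum n.+1 := exist _ (p v) (pz v).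
have QB : zmod_morphism Q.
  move=> u v; apply: val_inj; rewrite raddfB /= /p.
  under eq_bigr do rewrite !mxE.
  by rewrite sumrB scalerBl !opprD addrACA.
pose P v : sandpile g := (\pi_(sandpile g)%qT (Q v)).
have PB : zmod_morphism P.
  by move=> u v; rewrite /P QB raddfB.
have PK (x : sandpile g) : P (val (repr x)) = x.
  rewrite -[RHS]reprK /P; congr (\pi_(_)%qT _); apply: val_inj => /=.
  rewrite /p (eqP (valP (repr x))) scale0r subr0//.
pose H (c : {ffun 'I_n.+1 -> Zmod_sum a}) (x : sandpile g) : Zmod_sum a :=
  \sum_i c i *~ val (repr x) i 0.
apply: (@sub_finite_set _ _ (range H)); last exact/finite_image/finite_finset.
move=> f [fB _]; exists [ffun i => f (P (delta_mx i 0))] => //.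
apply/funext => x; rewrite -[in RHS](PK x).
have fPB : zmod_morphism (f \o P) by move=> u v; rewrite /= PB fB.
have /= -> := zmod_morphism_cV (val (repr x)) fPB.
by apply: eq_bigr => i _; rewrite ffunE.
Qed.

(* Main.v *)
Require Import Defs.
From HB Require Import structures.
From mathcomp Require Import all_boot all_order all_algebra.
From mathcomp Require Import separable cyclotomic complex finmap ring lra.
From mathcomp Require cyclic.
From mathcomp Require Import all_classical all_reals all_analysis.

Set Implicit Arguments.
Unset Strict Implicit.
Unset Printing Implicit Defensive.

Import Order.TTheory GRing.Theory Num.Theory.
Import numFieldNormedType.Exports.

Local Open Scope classical_set_scope.
Local Open Scope ring_scope.

(* A homomorphism from the sandpile group to a finite abelian group G is, up to
   translation, a coloring c of the vertices by G such that for every vertex j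
   the sum of c j - c i over the neighbours i of j vanishes; it is surjective
   iff the differences of c generate G.  Detecting these equations by Fourier
   analysis, with a perfect pairing b on G, and averaging over the edges gives
     E #Sur = |G|^-(n+1) * sum over (c, y) : [n] -> G x G, c generating, of
                prod over edges {i, j} of (1 - q + q b (y_i - y_j) (c_i - c_j)).
   Each factor is 1 if the two colors in G x G are compatible, that is if
   b (y_i - y_j) (c_i - c_j) = 1, and has modulus at most rho < 1 otherwise.
   Sets of pairwise compatible colors are translates of isotropic sets, so they
   have at most |G| elements.  The colorings whose image is a clique of size
   |G| contribute about |G|^n each clique; all the other ones are exponentially
   negligible, being concentrated on fewer than |G| colors or paying for many
   incompatible pairs.  The generating cliques of size |G| are the graphs of
   x |-> phi x + t with phi : G -> G alternating for b, and there are
   |G| * prod_i a_i^i of them. *)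

(** * Perfect pairings *)

Section Pairings.
Variable C : numClosedFieldType.

Record perfect_pairing (V : finZmodType) (b : V -> V -> C) : Prop :=
  PerfectPairing {
    pairing0l : forall z, b 0 z = 1;
    pairingDl : forall x y z, b (x + y) z = b x z * b y z;
    pairingC : forall x y, b x y = b y x;
    pairing_nondeg : forall x, (forall y, b x y = 1) -> x = 0 }.

Section PairingTheory.
Variables (V : finZmodType) (b : V -> V -> C).
Hypothesis bP : perfect_pairing b.

Lemma pairing0r z : b z 0 = 1.
Proof. by rewrite (pairingC bP) (pairing0l bP). Qed.

Lemma pairingDr x y z : b z (x + y) = b z x * b z y.
Proof. by rewrite !(pairingC bP z) (pairingDl bP). Qed.

Lemma pairing_neq0 x y : b x y != 0.
Proof.
apply/eqP => bxy; have := pairing0l bP y.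
by rewrite -(subrr x) (pairingDl bP) bxy mul0r => /esym/eqP; rewrite oner_eq0.
Qed.

(** The product of [b u y] over all u is nonzero and gets multiplied by [b x y ^+ #|V|] when u is
    shifted by x, so [b x y] is a root of unity. *)
Lemma pairing_norm x y : `|b x y| = 1.
Proof.
have : \prod_u b u y = b x y ^+ #|V| * \prod_u b u y.
  rewrite [LHS](reindex_inj (addrI x)) -prodr_const -big_split /=.
  by apply: eq_bigr => u _; rewrite (pairingDl bP).
rewrite -[LHS]mul1r => /mulIf -/(_ _)/esym bV.
apply/eqP; rewrite -(@pexpr_eq1 _ _ #|V|) //; last by apply/card_gt0P; exists x.
by rewrite -normrX bV ?normr1 //; apply/prodf_neq0 => u _; exact: pairing_neq0.
Qed.

Lemma pairingNl x y : b (- x) y = (b x y)^-1.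
Proof.
apply: (mulIf (pairing_neq0 x y)).
by rewrite -(pairingDl bP) addNr (pairing0l bP) mulVf ?pairing_neq0.
Qed.

Lemma pairingNr x y : b x (- y) = (b x y)^-1.
Proof. by rewrite (pairingC bP) pairingNl (pairingC bP). Qed.

Lemma pairingBl x y z : b (x - y) z = b x z / b y z.
Proof. by rewrite (pairingDl bP) pairingNl. Qed.

Lemma pairingBr x y z : b z (x - y) = b z x / b z y.
Proof. by rewrite pairingDr pairingNr. Qed.

Lemma pairing_conj x y : (b x y)^* = b x (- y).
Proof. by rewrite pairingNr invC_norm pairing_norm expr1n invr1 mul1r. Qed.

Lemma pairing_sumr (I : finType) (P : pred I) (F : I -> V) z :
  b z (\sum_(i | P i) F i) = \prod_(i | P i) b z (F i).
Proof. exact: (big_morph _ (fun x y => pairingDr x y z) (pairing0r z)). Qed.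

Lemma pairingMnr x y n : b x (y *+ n) = b x y ^+ n.
Proof.
elim: n => [|n IHn]; first by rewrite mulr0n pairing0r.
by rewrite mulrS exprS pairingDr IHn.
Qed.

Lemma pairing_orthogonality x : \sum_y b y x = (x == 0)%:R * #|V|%:R.
Proof.
have [->|x0] := eqVneq x 0.
  by under eq_bigr do rewrite pairing0r; rewrite sumr_const mul1r.
rewrite mul0r; have [/forallP bx1|] := boolP [forall y, b x y == 1].
  by case/eqP: x0; apply: (pairing_nondeg bP) => y; apply/eqP.
rewrite negb_forall => /existsP[z /negPf bz].
have /eqP : (\sum_y b y x) * (b x z - 1) = 0.
  apply/eqP; rewrite mulrBr mulr1 subr_eq0 mulr_suml [eqbRHS](reindex_inj (addIr z)).
  by apply/eqP/eq_bigr => y _; rewrite (pairingDl bP) (pairingC bP z).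
by rewrite mulf_eq0 subr_eq0 bz orbF => /eqP.
Qed.

(* Bessel: the sum over x of |sum over t in T of b x t|^2 equals |V||T|, and
   each x in T alone contributes |T|^2. *)
Lemma isotropic_card (T : {set V}) :
  {in T &, forall s t, b s t = 1} -> (#|T| ^ 2 <= #|V|)%N.
Proof.
move=> T1.
have sumT : \sum_x `|\sum_(t in T) b x t| ^+ 2 = (#|V| * #|T|)%:R.
  under eq_bigr => x _.
    rewrite normCK rmorph_sum mulr_suml.
    under eq_bigr => s sT.
      rewrite mulr_sumr.
      under eq_bigr => t tT do rewrite /= pairing_conj -pairingDr.
      over.
    over.
  rewrite exchange_big /=.
  under eq_bigr => s sT.
    rewrite exchange_big /=.
    under eq_bigr => t tT do rewrite pairing_orthogonality subr_eq0.
    rewrite (bigD1 s) //= eqxx mul1r big1 ?addr0 => [|t /andP[_ /negPf st]].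
      over.
    by rewrite eq_sym st mul0r.
  by rewrite sumr_const natrM mulr_natr.
have [->|T0] := eqVneq T finset.set0; first by rewrite cards0.
have : ((#|T| ^ 2) * #|T| <= #|V| * #|T|)%N.
  rewrite -(ler_nat C) -sumT [leRHS](bigID (mem T)) /=.
  apply: ler_wpDr; first by apply: sumr_ge0 => x _; rewrite exprn_ge0.
  under eq_bigr => x xT.
    under eq_bigr => t tT do rewrite T1 //.
    rewrite sumr_const normr_nat.
    over.
  by rewrite sumr_const natrM natrX mulr_natr.
by rewrite leq_pmul2r // card_gt0.
Qed.

End PairingTheory.
End Pairings.

(** * Colorings and incompatible pairs *)

Section Colorings.
Variables (V : finType) (comp : rel V).
Hypotheses (comp_sym : symmetric comp) (comp_refl : reflexive comp).

Definition clique (S : {set V}) : bool :=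
  [forall u in S, forall v in S, comp u v].

Lemma cliqueP (S : {set V}) :
  reflect {in S &, forall u v, comp u v} (clique S).
Proof.
apply: (iffP forall_inP) => [h u v uS vS|h u uS]; first exact: (forall_inP (h u uS)).
by apply/forall_inP => v; exact: h.
Qed.

Lemma cliqueU1 (S : {set V}) v :
  clique S -> {in S, forall u, comp v u} -> clique (v |: S)%SET.
Proof.
move=> /cliqueP cS vS; apply/cliqueP => x y.
rewrite !inE => /predU1P[->|xS] /predU1P[->|yS] //; last exact: cS.
- exact: vS.
- by rewrite comp_sym vS.
Qed.

Section Coloring.
Variables (n : nat) (f : {ffun 'I_n -> V}).

Definition conflict (e : edge n) : bool :=
  [exists i in val e, exists j in val e, ~~ comp (f i) (f j)].

Definition conflicts : nat := #|[set e | conflict e]%SET|.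

(** Each counted pair has one end colored outside S and the other inside, so the edge {i, j}
    determines which end is which and no edge is counted twice. *)
Lemma sum_conflicts (S : {set V}) :
  (\sum_(i | f i \notin S) #|[set j | (f j \in S) && ~~ comp (f i) (f j)]%SET|
     <= conflicts)%N.
Proof.
pose P := [set p : 'I_n * 'I_n |
  [&& f p.1 \notin S, f p.2 \in S & ~~ comp (f p.1) (f p.2)]]%SET.
have -> : (\sum_(i | f i \notin S)
    #|[set j | (f j \in S) && ~~ comp (f i) (f j)]%SET| = #|P|)%N.
  under eq_bigr do rewrite -sum1_card.
  by rewrite pair_big_dep -sum1_card; apply: eq_bigl => p /=; rewrite !inE.
have inj : {in P &, injective (fun p : 'I_n * 'I_n => [set p.1; p.2]%SET)}.
  move=> [i j] [i' j']; rewrite !inE /= => /and3P[iS jS _] /and3P[i'S j'S _] E.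
  have ij : i != j' by apply: contraNneq iS => ->.
  have ji : j != i' by apply: contraNneq i'S => <-.
  have : i \in [set i'; j']%SET by rewrite -E !inE eqxx.
  rewrite !inE (negPf ij) orbF => /eqP->.
  have : j \in [set i'; j']%SET by rewrite -E !inE eqxx orbT.
  by rewrite !inE (negPf ji) => /eqP->.
rewrite -(card_in_imset inj) /conflicts -[leqRHS](card_imset _ val_inj).
apply: subset_leq_card; apply/fintype.subsetP => _ /imsetP[[i j] + ->].
rewrite inE /= => /and3P[iS jS ij].
have e2 : #|[set i; j]%SET| == 2%N.
  by rewrite cards2; case: (i =P j) iS => [->|//]; rewrite jS.
apply/imsetP; exists (exist (fun e : {set 'I_n} => #|e| == 2%N) _ e2) => //.
rewrite inE; apply/exists_inP.
exists i; rewrite ?inE ?eqxx //; apply/exists_inP.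
by exists j; rewrite ?inE ?eqxx ?orbT.
Qed.

Lemma conflicts_eq0 : clique (f @: [set: 'I_n])%SET -> forall e, ~~ conflict e.
Proof.
move=> /cliqueP cf e; apply/negP => /exists_inP[i _ /exists_inP[j _]].
by rewrite cf ?imset_f ?inE.
Qed.

Definition weight (S : {set V}) : nat := #|[set i | f i \in S]%SET|.

Lemma heaviest_clique :
  exists2 S, clique S & forall S', clique S' -> (weight S' <= weight S)%N.
Proof.
have c0 : clique finset.set0 by apply/cliqueP => u v; rewrite inE.
by exists [arg max_(S > finset.set0 | clique S) weight S]; case: arg_maxnP.
Qed.

Section Heaviest.
Variable S : {set V}.
Hypotheses (cS : clique S) (hS : forall S', clique S' -> (weight S' <= weight S)%N).

(* Otherwise adding the color f i to S and dropping the colors in conflict with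
   it would give a heavier clique. *)
Lemma heaviest_conflict i : f i \notin S ->
  (weight [set f i]%SET <= #|[set j | (f j \in S) && ~~ comp (f i) (f j)]%SET|)%N.
Proof.
move=> iS; pose S' := [set s in S | comp (f i) s]%SET.
have cS' : clique (f i |: S')%SET.
  apply: cliqueU1 => [|u]; last by rewrite inE => /andP[].
  apply/cliqueP => u v; rewrite !inE => /andP[uS _] /andP[vS _].
  exact: (cliqueP _ cS).
have := hS cS'; rewrite /weight.
rewrite -[X in (_ <= X)%N -> _](cardsID [set j | comp (f i) (f j)]%SET).
rewrite -(cardsID [set j | f j == f i]%SET [set j | f j \in (f i |: S')]%SET).
have -> : [set i0 | f i0 \in f i |: S']%SET :&: [set j | f j == f i]%SET
    = [set j | f j \in [set f i]]%SET.
  by apply/setP => j; rewrite !inE andbC; case: eqP.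
have -> : [set i0 | f i0 \in f i |: S']%SET :\: [set j | f j == f i]%SET
    = [set i0 | f i0 \in S]%SET :&: [set j | comp (f i) (f j)]%SET.
  apply/setP => j; rewrite !inE; case: eqP => //= ->.
  by rewrite (negPf iS).
rewrite addnC leq_add2l => /leq_trans; apply; apply: subset_leq_card.
by apply/fintype.subsetP => j; rewrite !inE andbC.
Qed.

(** If k vertices are colored outside S, a most frequent color v among theirs is used at least k /
    |V| times. By [heaviest_conflict] each vertex colored v has at least as many conflicts with S as
    v has vertices, whence the square. *)
Lemma outside_le_conflicts :
  (#|[set i | f i \notin S]%SET| ^ 2 <= #|V| ^ 2 * conflicts)%N.
Proof.
have [->|[i0]] := set_0Vmem [set i | f i \notin S]%SET; first by rewrite cards0.
rewrite inE => i0S.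
have [v /= vS hv] :=
  @arg_maxnP _ (f i0) [pred v | v \notin S] (fun v => weight [set v]%SET) i0S.
have vk : (#|[set i | f i \notin S]%SET| <= #|V| * weight [set v]%SET)%N.
  rewrite -sum1_card (partition_big f (fun u => u \notin S)) /=; last first.
    by move=> i; rewrite inE.
  apply: leq_trans (_ : \sum_(u | u \notin S) weight [set v]%SET <= _)%N.
    apply: leq_sum => u uS; apply: leq_trans (hv u uS).
    rewrite sum1dep_card; apply: subset_leq_card.
    by apply/fintype.subsetP => i; rewrite !inE => /andP[].
  by rewrite sum_nat_const leq_mul2r max_card orbT.
apply: (@leq_trans ((#|V| * weight [set v]%SET) ^ 2)%N); first by rewrite leq_exp2r.
rewrite expnMn leq_mul2l; apply/orP; right; apply: leq_trans (sum_conflicts S).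
rewrite (bigID (fun i => f i == v)) /=; apply: leq_trans (leq_addr _ _).
rewrite -mulnn -[X in (X * _)%N]sum1_card big_distrl /=.
rewrite (eq_bigl (fun i => f i == v)); last by move=> i; rewrite !inE.
rewrite [leqRHS](eq_bigl (fun i => f i == v)); last first.
  by move=> i; rewrite andbC; case: eqP => // ->.
apply: leq_sum => i /eqP fi; rewrite mul1n -[in leqLHS]fi.
by apply: heaviest_conflict; rewrite fi.
Qed.

(** Some vertex is colored outside S. Its color is incompatible with some u in S, as S has maximal
    size, so it conflicts with every vertex colored u. *)
Lemma weight_le_conflicts v : (forall S', clique S' -> #|S'| <= #|S|)%N ->
  (forall u, u \in S -> weight [set v]%SET <= weight [set u]%SET)%N ->
  ~~ (f @: [set: 'I_n] \subset S)%SET -> (weight [set v]%SET <= conflicts)%N.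
Proof.
move=> maxS hv /subsetPn[_ /imsetP[i _ ->]] iS.
apply: leq_trans (sum_conflicts S); rewrite (bigD1 i) //=.
apply: leq_trans (leq_addr _ _).
have [u uS fu] : exists2 u, u \in S & ~~ comp (f i) u.
  apply/exists_inP; rewrite -negb_forall_in; apply/negP => /forall_inP h.
  by have := maxS _ (cliqueU1 cS h); rewrite cardsU1 iS ltnn.
apply: leq_trans (hv u uS) _; apply: subset_leq_card.
by apply/fintype.subsetP => j; rewrite !inE => /eqP->; rewrite uS.
Qed.

End Heaviest.
End Coloring.
End Colorings.

(** * Product majorants for colorings with conflicts *)

Section ColoringSums.
Variable R : realType.

(* A square beats a linear function, so rho ^+ (k ^ 2) / x ^+ k is bounded. *)
Lemma expr_square_bound (rho x : R) (M : nat) : 0 <= rho < 1 -> 0 < x <= 1 ->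
  exists2 B : R, 1 <= B &
    forall k m, (k ^ 2 <= M * m)%N -> rho ^+ m <= B * x ^+ k.
Proof.
move=> /andP[rho0 rho1] /andP[x0 x1].
have [K rhoK] : exists K : nat, rho ^+ K <= x.
  have /cvgr0Pnorm_le /(_ x x0)[K _ hK] : (fun n => rho ^+ n) @ \oo --> (0 : R).
    by apply: cvg_expr; rewrite ger0_norm.
  by exists K; have := hK K (leqnn K); rewrite /= ger0_norm // exprn_ge0.
have xn0 k : 0 < x ^+ k by rewrite exprn_gt0.
(* Since [rho ^+ K <= x], the bound holds without a constant once k is at least K * M; below that
   threshold this constant makes the right side at least 1. *)
exists (x ^- (K * M)); first by rewrite invf_ge1 // exprn_ile1 // ltW.
move=> k m km; have [kM|kM] := leqP (K * M) k.
  have Kkm : (K * k <= m)%N.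
    case: (posnP M) => [M0|M0].
      by move: km; rewrite M0 mul0n leqn0 expn_eq0 /= andbT => /eqP->; rewrite muln0.
    by rewrite -(leq_pmul2l M0) (leq_trans _ km) // mulnA (mulnC M) -mulnn leq_mul2r kM orbT.
  apply: (@le_trans _ _ (rho ^+ (K * k))); first by rewrite ler_wiXn2l // ltW.
  apply: (@le_trans _ _ (x ^+ k)).
    by rewrite exprM lerXn2r // ?nnegrE ?exprn_ge0 // ltW.
  by rewrite ler_peMl ?(ltW (xn0 k)) // invf_ge1 // exprn_ile1 // ltW.
apply: (@le_trans _ _ 1); first by rewrite exprn_ile1 // ltW.
by rewrite mulrC ler_pdivlMr // mul1r ler_wiXn2l ?(ltW x0) // ltnW.
Qed.

Section Bound.
Variables (V : finType) (comp : rel V).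
Hypotheses (comp_sym : symmetric comp) (comp_refl : reflexive comp).
Variables (r x : R).
Hypotheses (x0 : 0 < x) (xr : x <= r) (r1 : r < 1).

(** Summed over all colorings, the product of these weights over the vertices factors as a power of
    the sum over colors, and this base is below |S| + 1 for r < 1 and x small. *)
Definition color_weight (S : {set V}) (h v : V) : R :=
  if v \in S then 1 else if v == h then r else x.

Lemma color_weight_gt0 S h v : 0 < color_weight S h v.
Proof. by rewrite /color_weight; do 2?case: ifP => // _; exact: lt_le_trans xr. Qed.

Lemma sum_color_weight S h : \sum_v color_weight S h v <= #|S|%:R + r + x *+ #|V|.
Proof.
rewrite (bigID (mem S)) /= -addrA.
have -> : \sum_(i in S) color_weight S h i = #|S|%:R.
  by under eq_bigr => i iS do rewrite /color_weight iS; rewrite sumr_const.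
have r0 : 0 <= r by rewrite ltW // (lt_le_trans x0).
rewrite lerD2l; have [hS|hS] := boolP (h \in S).
  apply: (@le_trans _ _ (x *+ #|V|)); last by rewrite lerDr.
  rewrite (eq_bigr (fun=> x)) => [|i iS].
    by rewrite sumr_const ler_wpMn2l ?max_card // ltW.
  by rewrite /color_weight (negPf iS); case: eqP iS => // ->; rewrite hS.
rewrite (bigD1 h) //= {1}/color_weight (negPf hS) eqxx lerD2l.
rewrite (eq_bigr (fun=> x)) => [|i /andP[iS ih]].
  by rewrite sumr_const ler_wpMn2l ?max_card // ltW.
by rewrite /color_weight (negPf iS) (negPf ih).
Qed.

Lemma prod_color_weight n (f : {ffun 'I_n -> V}) S h :
  \prod_i color_weight S h (f i) =
    r ^+ #|[set i | (f i \notin S) && (f i == h)]%SET|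
    * x ^+ #|[set i | (f i \notin S) && (f i != h)]%SET|.
Proof.
rewrite (bigID (fun i => f i \in S)) /= big1 ?mul1r => [|i iS]; last first.
  by rewrite /color_weight iS.
rewrite (bigID (fun i => f i == h)) /=; congr (_ * _).
  rewrite (eq_bigr (fun=> r)) => [|i /andP[/negPf iS ih]].
    by rewrite prodr_const; congr (_ ^+ _); apply: eq_card => i; rewrite inE.
  by rewrite /color_weight iS ih.
rewrite (eq_bigr (fun=> x)) => [|i /andP[/negPf iS /negPf ih]].
  by rewrite prodr_const; congr (_ ^+ _); apply: eq_card => i; rewrite inE.
by rewrite /color_weight iS ih.
Qed.

Variable N : nat.
Hypotheses (N0 : (0 < N)%N)
  (clique_max : forall S, clique comp S -> (#|S| <= N)%N).

Definition max_clique (S : {set V}) : bool := clique comp S && (#|S| == N).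

(** One factor [r ^+ conflicts] pays for the vertices colored outside a heaviest clique S. If S has
    size N, it must lose a color h: one missed by f when the image lies in S, otherwise a least used
    one, whose uses are paid for by the second factor. If S is smaller, h is the dummy [v0]. *)
Lemma conflicts_bound (v0 : V) : exists2 B : R, 1 <= B &
  forall n (f : {ffun 'I_n -> V}), ~~ max_clique (f @: [set: 'I_n])%SET ->
  exists (S : {set V}) h, (#|S| < N)%N /\
    r ^+ (2 * conflicts comp f) <= B * \prod_i color_weight S h (f i).
Proof.
have r0 : 0 < r by exact: lt_le_trans xr.
have [||B B1 hB] := @expr_square_bound r x (#|V| ^ 2).
- by rewrite ltW.
- by rewrite x0 (le_trans xr) // ltW.
exists B => // n f bad.
have B0 : 0 <= B by rewrite (le_trans _ B1).
have [S cS hS] := heaviest_clique comp f.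
pose k := #|[set i | f i \notin S]%SET|.
have kB : r ^+ conflicts comp f <= B * x ^+ k.
  exact/hB/outside_le_conflicts.
have [SN|SN] := ltnP #|S| N.
  exists S, v0; split => //; rewrite prod_color_weight.
  apply: (@le_trans _ _ (r ^+ conflicts comp f)).
    by rewrite ler_wiXn2l // ?ltW // mul2n -addnn leq_addr.
  apply: le_trans kB _; rewrite ler_wpM2l //.
  rewrite /k -(cardsID [set i | f i == v0]%SET) exprD.
  have -> : [set i | f i \notin S]%SET :&: [set i | f i == v0]%SET
      = [set i | (f i \notin S) && (f i == v0)]%SET.
    by apply/setP => i; rewrite !inE.
  have -> : [set i | f i \notin S]%SET :\: [set i | f i == v0]%SET
      = [set i | (f i \notin S) && (f i != v0)]%SET.
    by apply/setP => i; rewrite !inE andbC.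
  rewrite ler_wpM2r ?exprn_ge0 ?(ltW x0) //.
  by rewrite lerXn2r // ?nnegrE ?(ltW x0) ?(ltW r0).
have SNE : #|S| = N by apply/eqP; rewrite eqn_leq SN clique_max.
have [s0 s0S] : exists s, s \in S by apply/card_gt0P; rewrite SNE.
have [imS|imS] := boolP (f @: [set: 'I_n] \subset S)%SET.
  have [h hS' hf] : exists2 h, h \in S & h \notin (f @: [set: 'I_n])%SET.
    apply/subsetPn; apply/negP => Sim.
    have E : (f @: [set: 'I_n])%SET = S by apply/eqP; rewrite finset.eqEsubset imS.
    by move: bad; rewrite E /max_clique cS SNE eqxx.
  exists (S :\ h)%SET, h; split.
    by rewrite -[ltnRHS]SNE [ltnRHS](cardsD1 h) hS'.
  rewrite big1 => [|i _].
    by rewrite mulr1 (le_trans _ B1) // exprn_ile1 // ltW.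
  have fi : f i \in (f @: [set: 'I_n])%SET by rewrite imset_f ?inE.
  rewrite /color_weight !inE (fintype.subsetP imS) // andbT.
  by case: eqP => // fih; case/negP: hf; rewrite -fih.
have [h /= hS' hmin] := @arg_minnP _ s0 (mem S) (fun v => weight f [set v]%SET) s0S.
exists (S :\ h)%SET, h; split.
  by rewrite -[ltnRHS]SNE [ltnRHS](cardsD1 h) hS'.
have hw : (weight f [set h]%SET <= conflicts comp f)%N.
  by apply: (@weight_le_conflicts _ _ comp_sym comp_refl _ f S) => //; rewrite SNE.
rewrite prod_color_weight mul2n -addnn exprD mulrCA.
apply: ler_pM; rewrite ?exprn_ge0 ?(ltW r0) //.
  rewrite ler_wiXn2l ?(ltW r0) ?(ltW r1) // (leq_trans _ hw) // /weight.
  by apply: subset_leq_card; apply/fintype.subsetP => i; rewrite !inE => /andP[].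
apply: le_trans kB _; rewrite ler_wpM2l // ler_wiXn2l ?(ltW x0) //.
  by rewrite (le_trans xr) // ltW.
apply: subset_leq_card; apply/fintype.subsetP => i; rewrite !inE.
by case: (f i == h) => //=; rewrite ?andbF ?andbT.
Qed.

End Bound.
End ColoringSums.

(** * Asymptotics of sums over colorings *)

Section CliqueSums.
Variable R : realType.
Local Notation "x %:C" := (real_complex R x) : ring_scope.
Variables (V : finType) (comp : rel V).
Hypotheses (comp_sym : symmetric comp) (comp_refl : reflexive comp).
Variables (N : nat) (N0 : (0 < N)%N).
Hypothesis clique_max : forall S, clique comp S -> (#|S| <= N)%N.
Variable P : pred {set V}.

Definition max_cliques : {set {set V}} :=
  [set S | max_clique comp N S & P S]%SET.

(** Exactly [N ^ n] colorings take their values in a given clique of size N. The main term thus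
    becomes a sum over colorings, to be compared with the weights term by term. *)
Lemma card_max_cliques_expn n :
  (#|max_cliques| * N ^ n)%N =
  (\sum_(f : {ffun 'I_n -> V})
     \sum_(S in max_cliques) (f @: [set: 'I_n] \subset S)%SET)%N.
Proof.
rewrite exchange_big /= -sum_nat_const; apply: eq_bigr => S.
rewrite inE => /andP[/andP[_ /eqP SN] _].
rewrite -[X in (X ^ n)%N]SN -[X in (_ ^ X)%N](card_ord n) -card_ffun_on.
rewrite -sum1_card big_mkcond /=; apply: eq_bigr => f _.
suff -> : (f @: [set: 'I_n] \subset S)%SET = (f \in ffun_on (mem S)) by case: ifP.
apply/fintype.subsetP/ffun_onP => [fS i|fS _ /imsetP[i _ ->] //].
by apply: fS; rewrite imset_f ?inE.
Qed.

Variables (rho : R) (rho0 : 0 <= rho) (rho1 : rho < 1).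

Section FixedSize.
Variables (n : nat) (w : {ffun 'I_n -> V} -> edge n -> R[i]).
Hypothesis w_conflict : forall f e, conflict comp f e -> `|w f e| <= rho%:C.
Hypothesis w_comp : forall f e, ~~ conflict comp f e -> w f e = 1.

Lemma norm_prod_weights f : `|\prod_e w f e| <= (rho ^+ conflicts comp f)%:C.
Proof.
have -> : conflicts comp f = #|conflict comp f|.
  by apply: eq_card => e; rewrite inE.
rewrite normr_prod rmorphXn /= (bigID (conflict comp f)) /=.
rewrite [X in _ * X]big1 ?mulr1 => [|e /w_comp->]; last by rewrite normr1.
apply: le_trans (_ : \prod_(e | conflict comp f e) rho%:C <= _).
  by apply: ler_prod => e fe; rewrite normr_ge0 w_conflict.
by rewrite prodr_const.
Qed.

(** A clique of size N contains the image only if it equals it, and without conflicts all weights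
    are 1: such colorings cause no error. *)
Lemma max_clique_weight (f : {ffun 'I_n -> V}) :
  max_clique comp N (f @: [set: 'I_n])%SET ->
  (P (f @: [set: 'I_n])%SET)%:R * \prod_e w f e
  = (\sum_(S in max_cliques) (f @: [set: 'I_n] \subset S)%SET)%:R.
Proof.
move=> fN; have /andP[cf /eqP fNE] := fN.
rewrite big1 ?mulr1 => [|e _]; last exact/w_comp/(conflicts_eq0 cf).
have eqS S : S \in max_cliques ->
    (f @: [set: 'I_n] \subset S)%SET = (S == (f @: [set: 'I_n])%SET).
  rewrite inE => /andP[/andP[_ /eqP SN] _].
  by rewrite eq_sym finset.eqEcard fNE SN leqnn andbT.
under eq_bigr => S SL do rewrite eqS //.
rewrite -big_mkcondr /= sum1dep_card.
have [Pf|Pf] := boolP (P _).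
  rewrite (@fintype.eq_card1 _ (f @: [set: 'I_n])%SET) // => S.
  by rewrite !inE; case: eqP => [->|]; rewrite ?andbF // fN Pf.
rewrite fintype.eq_card0 // => S; rewrite !inE; case: eqP => [->|]; rewrite ?andbF //.
by rewrite (negPf Pf) andbF.
Qed.

(** The clique count is nonzero only if the image lies in a clique; then there is no conflict and
    the power of [rho] is 1. *)
Lemma nonmax_clique_weight (f : {ffun 'I_n -> V}) :
  `|(P (f @: [set: 'I_n])%SET)%:R * \prod_e w f e
    - (\sum_(S in max_cliques) (f @: [set: 'I_n] \subset S)%SET)%:R|
  <= ((1 + #|max_cliques|%:R) * rho ^+ conflicts comp f)%:C.
Proof.
have cR0 : 0 <= (rho ^+ conflicts comp f)%:C by rewrite ler0c exprn_ge0.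
rewrite rmorphM rmorphD /= mulrDl rmorph1 mul1r rmorph_nat.
apply: le_trans (ler_normB _ _) _; apply: lerD.
  apply: le_trans (norm_prod_weights f).
  by case: (P _); rewrite ?mul1r // mul0r normr0.
rewrite normr_nat -sum1_card !natr_sum mulr_suml; apply: ler_sum => S.
rewrite inE => /andP[/andP[/cliqueP cS _] _]; rewrite mul1r.
case: (boolP (_ \subset _)) => // /fintype.subsetP fS.
suff -> : conflicts comp f = 0%N by [].
have cf : clique comp (f @: [set: 'I_n])%SET.
  by apply/cliqueP => u v /fS uS /fS vS; exact: cS.
by apply: fintype.eq_card0 => e; rewrite inE; exact/negbTE/(conflicts_eq0 cf).
Qed.

End FixedSize.

Lemma clique_sum_asymptotics (v0 : V) : exists K theta : R,
  [/\ 0 <= K, 0 <= theta < N%:R &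
   forall n (w : {ffun 'I_n -> V} -> edge n -> R[i]),
     (forall f e, conflict comp f e -> `|w f e| <= rho%:C) ->
     (forall f e, ~~ conflict comp f e -> w f e = 1) ->
     `|\sum_(f : {ffun 'I_n -> V} | P (f @: [set: 'I_n])%SET) \prod_e w f e
       - (#|max_cliques| * N ^ n)%:R| <= (K * theta ^+ n)%:C].
Proof.
have [rho0' rho1'] := (rho0, rho1).
(* The midpoint of [rho] and 1 satisfies [rho <= r ^+ 2], which supplies the two factors
   [r ^+ conflicts] that [conflicts_bound] needs. *)
pose r : R := (1 + rho) / 2.
have rhor : rho <= r ^+ 2.
  rewrite -subr_ge0 (_ : _ - rho = ((1 - rho) / 2) ^+ 2) ?sqr_ge0 //.
  by rewrite /r; field.
(* Chosen with x * (|V| + 1) = (1 - r) / 2, so that the base [theta] below stays under N. *)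
pose x : R := (1 - r) / (2 * (#|V|%:R + 1)).
have r1 : r < 1 by rewrite /r; lra.
have rge : 1 / 2 <= r by rewrite /r; lra.
have V0 : 0 <= #|V|%:R :> R by [].
have x0 : 0 < x by rewrite divr_gt0 //; lra.
have xV : x * #|V|%:R + x = (1 - r) / 2.
  by rewrite /x; field; rewrite gt_eqF //; lra.
have xV0 : 0 <= x * #|V|%:R by rewrite mulr_ge0 // ltW.
have xr : x <= r by lra.
have [B B1 hB] := conflicts_bound comp_sym comp_refl x0 xr r1 N0 clique_max v0.
pose theta := N.-1%:R + r + x *+ #|V|.
exists ((1 + #|max_cliques|%:R) * (B * #|{: {set V} * V}|%:R)), theta; split.
- by rewrite !mulr_ge0 ?addr_ge0 // (le_trans _ B1).
- have -> : N%:R = N.-1%:R + 1 :> R by rewrite natr1 prednK.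
  have N1 : 0 <= N.-1%:R :> R by [].
  rewrite /theta -[x *+ _]mulr_natr; apply/andP; split; first by rewrite !addr_ge0 //; lra.
  by rewrite -addrA ltrD2l; lra.
move=> n w w1 w2.
have B0 : 0 <= B by rewrite (le_trans _ B1).
have r0 : 0 <= r by rewrite (le_trans _ rge) // divr_ge0.
rewrite card_max_cliques_expn natr_sum big_mkcond /= -sumrB.
apply: le_trans (ler_norm_sum _ _ _) _.
pose T (f : {ffun 'I_n -> V}) := \sum_(p : {set V} * V | (#|p.1| < N)%N)
  \prod_i color_weight r x p.1 p.2 (f i).
apply: le_trans (_ : \sum_(f : {ffun 'I_n -> V}) ((1 + #|max_cliques|%:R) * (B * T f))%:C <= _).
  apply: ler_sum => f _.
  have -> : (if P (f @: [set: 'I_n])%SET then \prod_e w f e else 0) =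
      (P (f @: [set: 'I_n])%SET)%:R * \prod_e w f e.
    by case: (P _); rewrite ?mul1r ?mul0r.
  have T0 : 0 <= T f.
    apply: sumr_ge0 => p _; apply: prodr_ge0 => i _.
    exact/ltW/color_weight_gt0.
  have [fN|fN] := boolP (max_clique comp N (f @: [set: 'I_n])%SET).
    by rewrite (max_clique_weight w2 fN) subrr normr0 ler0c !mulr_ge0 ?addr_ge0.
  apply: le_trans (nonmax_clique_weight w1 w2 f) _; rewrite lecR.
  rewrite ler_wpM2l ?addr_ge0 //.
  have [S [h [SN hf]]] := hB n f fN.
  apply: (@le_trans _ _ (r ^+ (2 * conflicts comp f))).
    rewrite exprM; apply: lerXn2r; rewrite ?nnegrE ?exprn_ge0 //.
  apply: le_trans hf _; rewrite ler_wpM2l // /T (bigD1 (S, h)) //= lerDl.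
  apply: sumr_ge0 => p _; apply: prodr_ge0 => i _.
  exact/ltW/color_weight_gt0.
rewrite -rmorph_sum /= lecR -mulr_sumr -mulrA ler_wpM2l ?addr_ge0 //.
rewrite -mulr_sumr -mulrA ler_wpM2l // /T exchange_big /=.
apply: le_trans (_ : \sum_(p : {set V} * V | (#|p.1| < N)%N) theta ^+ n <= _).
  apply: ler_sum => -[S h] /= SN.
  rewrite -(bigA_distr_bigA (fun _ : 'I_n => color_weight r x S h)) /=.
  rewrite prodr_const card_ord; apply: lerXn2r; rewrite ?nnegrE.
  - by apply: sumr_ge0 => v _; exact/ltW/color_weight_gt0.
  - by rewrite /theta !addr_ge0 // mulrn_wge0 // ltW.
  apply: le_trans (sum_color_weight x0 xr S h) _.
  by rewrite /theta !lerD2r ler_nat -ltnS prednK.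
rewrite sumr_const mulr_natl ler_wpMn2l ?max_card // exprn_ge0 //.
by rewrite /theta !addr_ge0 // mulrn_wge0 // ltW.
Qed.

End CliqueSums.

(** * Cliques of maximal size *)

HB.instance Definition _ (A B : finZmodType) := Finite.on (A * B)%type.

Section Generation.
Variable G : finZmodType.

Definition generates_differences (X : {set G}) : bool :=
  `[< forall K : {set G}, zmod_closed (mem K) ->
      {in X &, forall x y, x - y \in K} -> K = [set: G]%SET >].

End Generation.

Section Lagrangians.
Variables (C : numClosedFieldType) (G : finZmodType) (b : G -> G -> C).
Hypothesis bP : perfect_pairing b.

Definition hyperbolic (u v : G * G) : C := b u.1 v.2 * b u.2 v.1.

Lemma hyperbolic_pairing : perfect_pairing (V := (G * G)%type) hyperbolic.
Proof.
split=> [z|x y z|x y|x x1]; rewrite /hyperbolic /=.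
- by rewrite !(pairing0l bP) mul1r.
- by rewrite !(pairingDl bP) mulrACA.
- by rewrite mulrC; congr (_ * _); rewrite (pairingC bP).
- have [x10 x20] : x.1 = 0 /\ x.2 = 0.
    split; apply: (pairing_nondeg bP) => y.
      by have := x1 (0, y); rewrite /hyperbolic /= (pairing0r bP) mulr1.
    by have := x1 (y, 0); rewrite /hyperbolic /= (pairing0r bP) mul1r.
  by rewrite [x]surjective_pairing x10 x20.
Qed.

(** The quadratic form u |-> b u.2 u.1, whose polarization is [hyperbolic], is trivial on u - v. *)
Definition compatible (u v : G * G) : bool := b (u.2 - v.2) (u.1 - v.1) == 1.

Lemma compatible_sym : symmetric compatible.
Proof.
move=> u v; rewrite /compatible -[v.2 - u.2]opprB -[v.1 - u.1]opprB.
by rewrite (pairingNl bP) (pairingNr bP) invrK.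
Qed.

Lemma compatible_refl : reflexive compatible.
Proof. by move=> u; rewrite /compatible !subrr (pairing0l bP). Qed.

(* Polarization of the quadratic form u |-> b u.2 u.1. *)
Lemma clique_isotropic (S : {set G * G}) s0 : clique compatible S -> s0 \in S ->
  {in S &, forall s t, hyperbolic (s - s0) (t - s0) = 1}.
Proof.
move=> /cliqueP cS s0S s t sS tS; rewrite /hyperbolic /=.
have /eqP := cS _ _ sS tS.
have -> : s.2 - t.2 = (s.2 - s0.2) - (t.2 - s0.2) by rewrite opprB addrA subrK.
have -> : s.1 - t.1 = (s.1 - s0.1) - (t.1 - s0.1) by rewrite opprB addrA subrK.
have /eqP := cS _ _ sS s0S; have /eqP := cS _ _ tS s0S.
move: (s.1 - s0.1) (s.2 - s0.2) (t.1 - s0.1) (t.2 - s0.2) => p1 p2 q1 q2 q21 p21.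
rewrite (pairingBl bP) !(pairingBr bP) p21 q21 div1r divr1 -invfM.
by move=> /(congr1 GRing.inv); rewrite invrK invr1 mulrC (pairingC bP q2).
Qed.

Lemma isotropic_card_le (T : {set G * G}) :
  {in T &, forall s t, hyperbolic s t = 1} -> (#|T| <= #|G|)%N.
Proof.
move=> /(isotropic_card hyperbolic_pairing).
by rewrite card_prod mulnn leq_exp2r.
Qed.

Lemma clique_card_le (S : {set G * G}) : clique compatible S -> (#|S| <= #|G|)%N.
Proof.
move=> cS; have [->|[s0 s0S]] := set_0Vmem S; first by rewrite cards0.
rewrite -(card_imset _ (addIr (- s0) : injective (fun s => s - s0))).
apply: isotropic_card_le => _ _ /imsetP[s sS ->] /imsetP[t tS ->].
exact: clique_isotropic cS s0S _ _ sS tS.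
Qed.

(* The translate of a maximal clique to the origin is closed under subtraction,
   since adding a difference to it would keep it isotropic. *)
Lemma max_clique_sub (S : {set G * G}) s0 : max_clique compatible #|G| S ->
  s0 \in S -> {in S &, forall s t, s - t + s0 \in S}.
Proof.
move=> /andP[cS /eqP SG] s0S s t sS tS; apply/negPn/negP => stS.
pose f (u : G * G) : G * G := u - s0.
have f_inj : injective f by exact: addIr.
have iso := clique_isotropic cS s0S.
have h1 u : u \in S -> hyperbolic (s - t) (u - s0) = 1.
  move=> uS; have -> : s - t = (s - s0) - (t - s0) by rewrite opprB addrA subrK.
  by rewrite (pairingBl hyperbolic_pairing) !iso // divr1.
have h2 : hyperbolic (s - t) (s - t) = 1.
  rewrite {2}(_ : s - t = (s - s0) - (t - s0)); last by rewrite opprB addrA subrK.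
  by rewrite (pairingBr hyperbolic_pairing) !h1 // divr1.
have : (#|f @: ((s - t + s0)%R |: S)%SET| <= #|G|)%N.
  apply: isotropic_card_le => _ _ /imsetP[u + ->] /imsetP[v + ->].
  rewrite !inE /f => /predU1P[->|uS] /predU1P[->|vS]; rewrite ?addrK ?h1 //.
    by rewrite (pairingC hyperbolic_pairing) h1.
  exact: iso.
by rewrite card_imset // cardsU1 stS SG add1n ltnn.
Qed.

(** Through b these are the alternating bilinear forms on G: phi corresponds to (x, y) |-> b (phi x)
    y. *)
Definition alternating : {set {ffun G -> G}} :=
  [set phi : {ffun G -> G} | [forall x, forall y, phi (x + y) == phi x + phi y] &&
             [forall x, b (phi x) x == 1]]%SET.

Lemma alternatingP (phi : {ffun G -> G}) :
  reflect ((forall x y, phi (x + y) = phi x + phi y) /\ (forall x, b (phi x) x = 1))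
          (phi \in alternating).
Proof.
rewrite inE; apply: (iffP andP) => -[].
  by move=> /'forall_'forall_eqP h1 /'forall_eqP h2.
by move=> h1 h2; split; [apply/'forall_'forall_eqP | apply/'forall_eqP].
Qed.

Definition affine_graph (p : G * {ffun G -> G}) : {set G * G} :=
  [set (x, p.2 x + p.1) | x : G]%SET.

Lemma fst_affine_graph p : fst @: affine_graph p = [set: G]%SET.
Proof.
apply/setP => x; rewrite inE; apply/imsetP; exists (x, p.2 x + p.1) => //.
exact: imset_f.
Qed.

Definition lagrangians : {set {set G * G}} :=
  max_cliques compatible #|G|
    (fun S => generates_differences (fst @: S : {set G})).

(** Differences of points of the graph have the form (u, phi u), so compatibility is the alternating
    condition. *)
Lemma affine_graph_lagrangian p :
  p \in finset.setX [set: G] alternating -> affine_graph p \in lagrangians.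
Proof.
case: p => t phi; rewrite finset.in_setX => /andP[_ /alternatingP[phiD phi1]].
have phiB x y : phi (x - y) = phi x - phi y.
  by apply: (addIr (phi y)); rewrite -phiD !subrK.
rewrite inE fst_affine_graph -andbA; apply/and3P; split.
- apply/cliqueP => _ _ /imsetP[x _ ->] /imsetP[y _ ->].
  by rewrite /compatible /= opprD addrACA subrr addr0 -phiB phi1.
- by rewrite card_imset ?cardsT // => x y [].
- apply/asboolP => K _ KG; apply/setP => x; rewrite [RHS]inE.
  by rewrite -[x]subr0 KG ?inE.
Qed.

Lemma affine_graph_inj :
  {in finset.setX [set: G] alternating &, injective affine_graph}.
Proof.
move=> [t phi] [t' phi'] /finset.setXP[_ /alternatingP[phiD _]].
move=> /finset.setXP[_ /alternatingP[phiD' _]] E.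
have phit x : phi x + t = phi' x + t'.
  have : (x, phi x + t) \in affine_graph (t', phi') by rewrite -E imset_f.
  by case/imsetP => y _ /= [<-].
have phi0 (h : {ffun G -> G}) : (forall x y, h (x + y) = h x + h y) -> h 0 = 0.
  by move=> hD; apply: (addrI (h 0)); rewrite -hD !addr0.
have tt' : t = t' by have := phit 0; rewrite !phi0 // !add0r.
rewrite tt'; congr pair; apply/ffunP => x.
by apply: (addIr t); rewrite phit tt'.
Qed.

(** By [max_clique_sub], the first coordinates minus that of s0 form a subgroup containing all their
    differences, hence all of G. As S has |G| elements it is the graph of a function, which closure
    under subtraction makes affine. *)
Lemma lagrangian_affine_graph S : S \in lagrangians ->
  exists2 p, p \in finset.setX [set: G] alternating & S = affine_graph p.
Proof.
rewrite inE => /andP[mS /asboolP gS]; have /andP[/cliqueP cS /eqP SG] := mS.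
have [s0 s0S] : exists s, s \in S.
  by apply/card_gt0P; rewrite SG; apply/card_gt0P; exists 0.
have subS := max_clique_sub mS s0S.
pose K := [set s.1 - s0.1 | s in S]%SET.
have KT : K = [set: G]%SET.
  apply: gS; first split.
  - by apply/imsetP; exists s0; rewrite ?subrr.
  - move=> _ _ /imsetP[s sS ->] /imsetP[t tS ->].
    by apply/imsetP; exists (s - t + s0); rewrite ?subS //= opprB addrA subrK addrK.
  move=> _ _ /imsetP[s sS ->] /imsetP[t tS ->].
  by apply/imsetP; exists (s - t + s0); rewrite ?subS //= addrK.
have fst_inj : {in S &, injective fst}.
  apply/imset_injP; rewrite SG.
  rewrite -(card_imset _ (addIr (- s0.1) : injective (fun x => x - s0.1))) -imset_comp.
  by apply/eqP; rewrite -(cardsT G) -KT.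
have fst_surj x : exists2 s, s \in S & s.1 = x.
  have : x - s0.1 \in K by rewrite KT inE.
  by case/imsetP => s sS /addIr; exists s.
have /boolp.choice[g gP] : forall x, exists s, s \in S /\ s.1 = x.
  by move=> x; have [s sS sx] := fst_surj x; exists s.
have gS' x : g x \in S by case: (gP x).
have g1 x : (g x).1 = x by case: (gP x).
have gB x y : g (x - y) = g x - g y + g 0.
  by apply: fst_inj => //=; rewrite ?(max_clique_sub mS) // !g1 addr0.
exists ((g 0).2, [ffun x => (g x).2 - (g 0).2]).
  rewrite finset.in_setX inE /=; apply/alternatingP; split => [x y|x]; rewrite !ffunE.
    rewrite -{1}[y]opprK gB -[- y]sub0r gB /= addrK opprD opprB.
    by rewrite [RHS]addrAC addrA.
  by have /eqP := cS _ _ (gS' x) (gS' 0); rewrite !g1 subr0.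
have sub : S \subset affine_graph ((g 0).2, [ffun x => (g x).2 - (g 0).2]).
  apply/fintype.subsetP => s sS; apply/imsetP; exists s.1 => //=.
  rewrite ffunE subrK; have -> : g s.1 = s by apply: fst_inj; rewrite ?gS' ?g1.
  by case: s sS.
apply/eqP; rewrite finset.eqEcard sub card_imset; last by move=> x y [].
by rewrite SG /= max_card.
Qed.

Lemma card_lagrangians : #|lagrangians| = (#|G| * #|alternating|)%N.
Proof.
rewrite -[in RHS](cardsT G) -finset.cardsX -(card_in_imset affine_graph_inj).
apply: eq_card => S; apply/idP/imsetP => [/lagrangian_affine_graph //|[p pA ->]].
exact: affine_graph_lagrangian.
Qed.

End Lagrangians.

(** * Alternating maps of a sum of cyclic groups *)

Section ZmodSumPairing.
Variables (C : numClosedFieldType) (r : nat) (a : 'I_r -> nat).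
Hypothesis a_gt0 : forall i, (0 < a i)%N.
Variables (m : nat) (z : C).
Hypotheses (z_prim : m.-primitive_root z) (a_dvd_m : forall i, (a i %| m)%N).

(** All these roots are powers of one z, so if a k divides a j, the root for k is the power of the
    root for j with exponent a j / a k; [zchar_lower_adj] relies on this. *)
Definition zroot (i : 'I_r) : C := z ^+ (m %/ a i).

Lemma zroot_prim i : (a i).-primitive_root (zroot i).
Proof. exact: dvdn_prim_root. Qed.

Definition zchar (i : 'I_r) (u : Zmod (a i)) : C := zroot i ^+ u.

Lemma val_inZp i k : (inZp k : Zmod (a i)) = (k %% a i)%N :> nat.
Proof. by rewrite /= prednK. Qed.

Lemma zchar_inZp i k : zchar (inZp k : Zmod (a i)) = zroot i ^+ k.
Proof. by rewrite /zchar val_inZp (expr_mod _ (prim_expr_order (zroot_prim i))). Qed.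

Lemma zchar0 i : zchar (0 : Zmod (a i)) = 1.
Proof. by []. Qed.

Lemma zcharD i (u v : Zmod (a i)) : zchar (u + v) = zchar u * zchar v.
Proof. by rewrite -exprD -zchar_inZp. Qed.

Lemma zchar_eq1 i (u : Zmod (a i)) : zchar u = 1 -> u = 0.
Proof.
move=> /eqP; rewrite -(prim_order_dvd (zroot_prim i)) => au.
have ua : (u < a i)%N by rewrite -[ltnRHS]prednK.
by apply: val_inj => /=; rewrite -(modn_small ua); exact/eqP.
Qed.

Lemma zchar_neq0 i (u : Zmod (a i)) : zchar u != 0.
Proof.
rewrite expf_neq0 //; apply: contraTneq isT => zi.
have := prim_expr_order (zroot_prim i); rewrite zi expr0n.
by rewrite eqn0Ngt a_gt0 => /esym/eqP; rewrite oner_eq0.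
Qed.

Lemma zcharN i (u : Zmod (a i)) : zchar (- u) = (zchar u)^-1.
Proof.
by apply: (mulIf (zchar_neq0 u)); rewrite -zcharD addNr zchar0 mulVf ?zchar_neq0.
Qed.

Lemma zcharMn i (u : Zmod (a i)) n : zchar (u *+ n) = zchar u ^+ n.
Proof.
elim: n => [|n IHn]; first by rewrite mulr0n zchar0.
by rewrite mulrS exprS zcharD IHn.
Qed.

Lemma zchar_sum (I : finType) i (F : I -> Zmod (a i)) :
  zchar (\sum_k F k) = \prod_k zchar (F k).
Proof. exact: (big_morph _ (@zcharD i) (zchar0 i)). Qed.

Definition zpairing (x y : Zmod_sum a) : C := \prod_i zchar (x i) ^+ y i.

Lemma zpairingC x y : zpairing x y = zpairing y x.
Proof.
by apply: eq_bigr => i _; rewrite /zchar -!exprM [(x i * y i)%N]mulnC.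
Qed.

Definition zbasis (i : 'I_r) : Zmod_sum a :=
  [ffun j => if j == i then inZp 1 else 0 : Zmod (a j)].

Lemma Zmod_mulrn_mod i (u : Zmod (a i)) k n :
  u *+ k = 0 -> u *+ (n %% k) = u *+ n.
Proof.
by move=> uk; rewrite {2}(divn_eq n k) mulrnDr mulnC mulrnA uk mul0rn add0r.
Qed.

(** The sum u + v is reduced modulo [a i] before it serves as a multiplier, which does no harm
    because [a i] kills t. *)
Lemma Zmod_mulrnD i j (t : Zmod (a j)) (u v : Zmod (a i)) :
  t *+ a i = 0 -> t *+ (u + v)%R = t *+ u + t *+ v.
Proof.
by move=> ti; rewrite -mulrnDr -(Zmod_mulrn_mod (u + v)%N ti) -val_inZp.
Qed.

Lemma Zmod_mulrn_order i (u : Zmod (a i)) : u *+ a i = 0.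
Proof.
apply: zchar_eq1; rewrite zcharMn -exprM mulnC exprM.
by rewrite (prim_expr_order (zroot_prim i)) expr1n.
Qed.

Lemma zpairing_basis x i : zpairing x (zbasis i) = zchar (x i).
Proof.
rewrite /zpairing (bigD1 i) //= big1 ?mulr1 => [|j /negPf ji]; last first.
  by rewrite ffunE ji expr0.
rewrite ffunE eqxx val_inZp -zcharMn Zmod_mulrn_mod ?mulr1n //.
exact: Zmod_mulrn_order.
Qed.

Lemma zpairingP : perfect_pairing (V := Zmod_sum a) zpairing.
Proof.
split=> [x|x y w|x y|x x1].
- by rewrite /zpairing big1 // => i _; rewrite ffunE zchar0 expr1n.
- rewrite /zpairing -big_split; apply: eq_bigr => i _ /=.
  by rewrite ffunE zcharD exprMn.
- exact: zpairingC.
- apply/ffunP => i; rewrite ffunE; apply: zchar_eq1.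
  by rewrite -zpairing_basis.
Qed.

Lemma Zmod_sum_basis x : x = \sum_i zbasis i *+ x i :> Zmod_sum a.
Proof.
have evD (y w : Zmod_sum a) j : (y + w) j = y j + w j by rewrite ffunE.
have ev0 j : (0 : Zmod_sum a) j = 0 by rewrite ffunE.
have evM (y : Zmod_sum a) n j : (y *+ n) j = y j *+ n.
  by elim: n => [|n IHn]; rewrite ?mulr0n ?ev0 // !mulrS evD IHn.
apply/ffunP => j; rewrite (big_morph (fun y : Zmod_sum a => y j) (fun y w => evD y w j) (ev0 j)).
rewrite (bigD1 j) //= big1 ?addr0 => [|i /negPf ij]; last first.
  by rewrite evM ffunE eq_sym ij mul0rn.
rewrite evM ffunE eqxx; apply: val_inj.
rewrite -[inZp 1 *+ _]/((inZp 1 : 'I_(a j).-1.+1) *+ x j) Zp_mulrn /=.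
by rewrite modnMml mul1n modn_small.
Qed.

Hypothesis a_dvd : forall i j : 'I_r, (i <= j)%N -> (a j %| a i)%N.

Let alt := alternating (G := Zmod_sum a) zpairing.

(** The alternating condition at a sum of two basis vectors makes the form antisymmetric, and its
    diagonal is trivial. So the given entries determine it on all pairs of basis vectors, hence
    everywhere, and nondegeneracy recovers the map. *)
Lemma alternating_ext (phi psi : {ffun Zmod_sum a -> Zmod_sum a}) :
  phi \in alt -> psi \in alt ->
  (forall i j : 'I_r, (i < j)%N -> phi (zbasis i) j = psi (zbasis i) j) ->
  phi = psi.
Proof.
move=> /(alternatingP) [phiD phi1] /alternatingP[psiD psi1] E.
pose bil (f : {ffun Zmod_sum a -> Zmod_sum a}) i j := zpairing (f (zbasis i)) (zbasis j).
have anti (f : {ffun Zmod_sum a -> Zmod_sum a}) :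
    (forall x y, f (x + y) = f x + f y) -> (forall x, zpairing (f x) x = 1) ->
    forall i j, bil f i j = (bil f j i)^-1.
  move=> fD f1 i j; have := f1 (zbasis i + zbasis j).
  rewrite fD (pairingDl zpairingP) !(pairingDr zpairingP) !f1 mul1r mulr1.
  have nz := pairing_neq0 zpairingP (f (zbasis j)) (zbasis i).
  by move=> h; apply: (mulIf nz); rewrite h mulVf.
have bilE i j : bil phi i j = bil psi i j.
  case: (ltngtP i j) => [ij|ij|/val_inj ->].
  - by rewrite /bil !zpairing_basis E.
  - by rewrite anti // [RHS]anti // /bil !zpairing_basis E.
  - by rewrite /bil phi1 psi1.
have addsum (f : {ffun Zmod_sum a -> Zmod_sum a}) x :
    (forall x y, f (x + y) = f x + f y) -> f x = \sum_i f (zbasis i) *+ x i.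
  move=> fD; have f0 : f 0 = 0 by apply: (addrI (f 0)); rewrite -fD !addr0.
  rewrite {1}[x]Zmod_sum_basis (big_morph f fD f0); apply: eq_bigr => i _.
  by elim: (nat_of_ord (x i)) => [|n IHn]; rewrite ?mulr0n // !mulrS fD IHn.
apply/ffunP => x; apply/eqP; rewrite -subr_eq0; apply/eqP.
apply: (pairing_nondeg zpairingP) => y; rewrite (pairingBl zpairingP).
suff -> : zpairing (phi x) y = zpairing (psi x) y.
  by rewrite divff // pairing_neq0 //; exact: zpairingP.
rewrite addsum // [psi x]addsum // {1 2}[y]Zmod_sum_basis.
rewrite !(pairing_sumr zpairingP); apply: eq_bigr => j _.
rewrite !(pairingMnr zpairingP); congr (_ ^+ _).
rewrite !(pairingC zpairingP _ (zbasis j)) !(pairing_sumr zpairingP).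
apply: eq_bigr => i _; rewrite !(pairingMnr zpairingP); congr (_ ^+ _).
by rewrite !(pairingC zpairingP (zbasis j)); exact: bilE.
Qed.

(** Strictly lower triangular matrices, with a j ^ j choices for row j. The entries are free: for i
    < j, a j divides a i, so a i kills every element of Z/a j. *)
Local Notation lower := {dffun forall j : 'I_r, {ffun 'I_j -> Zmod (a j)}}.

Definition lower_entry (M : lower) (j i : 'I_r) : Zmod (a j) :=
  if insub (i : nat) is Some k then M j k else 0.

Lemma lower_entry0 M (j i : 'I_r) : (j <= i)%N -> lower_entry M j i = 0.
Proof. by move=> ji; rewrite /lower_entry insubN // -leqNgt. Qed.

(* Antisymmetry forces the entries on the other side of the diagonal: the
   factor a j / a k embeds Z/a k into Z/a j compatibly with the pairing. *)
Definition lower_adj_entry (M : lower) (j k : 'I_r) : Zmod (a j) :=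
  inZp (a j %/ a k * lower_entry M k j).

Lemma lower_adj_entry0 M (j k : 'I_r) : (k <= j)%N -> lower_adj_entry M j k = 0.
Proof.
by move=> kj; apply: val_inj; rewrite /= lower_entry0 //= muln0 mod0n.
Qed.

Definition lower_map (M : lower) : {ffun Zmod_sum a -> Zmod_sum a} :=
  [ffun x => [ffun j => \sum_i lower_entry M j i *+ (x : Zmod_sum a) i
                      - \sum_k lower_adj_entry M j k *+ (x : Zmod_sum a) k]].

Lemma lower_entry_order M j i : lower_entry M j i *+ a i = 0.
Proof.
have [ij|ji] := ltnP i j; last by rewrite lower_entry0 // mul0rn.
by rewrite -(divnK (a_dvd (ltnW ij))) mulnC mulrnA Zmod_mulrn_order mul0rn.
Qed.

Lemma zchar_lower_adj M j k : zchar (lower_adj_entry M j k) = zchar (lower_entry M k j).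
Proof.
have [jk|kj] := ltnP j k; last by rewrite lower_adj_entry0 // lower_entry0.
rewrite zchar_inZp exprM /zchar /zroot; congr (_ ^+ _); rewrite -exprM; congr (_ ^+ _).
by rewrite muln_divA ?a_dvd 1?ltnW // divnK.
Qed.

Lemma lower_adj_entry_order M j k : lower_adj_entry M j k *+ a k = 0.
Proof.
by apply: zchar_eq1; rewrite zcharMn zchar_lower_adj -zcharMn Zmod_mulrn_order.
Qed.

Lemma lower_map_alternating M : lower_map M \in alt.
Proof.
apply/alternatingP; split => [x y|x].
  apply/ffunP => j; rewrite !ffunE addrACA -opprD -!big_split /=.
  congr (_ - _); apply: eq_bigr => i _; rewrite ffunE Zmod_mulrnD //.
    exact: lower_entry_order.
  exact: lower_adj_entry_order.
(* By [zchar_lower_adj], an entry and its adjoint have the same character value, so the two double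
   products differ by a swap of indices and cancel. *)
pose e (j i : 'I_r) : C := zchar (lower_entry M j i) ^+ (x i * x j).
have -> : zpairing (lower_map M x) x = \prod_j ((\prod_i e j i) / (\prod_i e i j)).
  apply: eq_bigr => j _; rewrite !ffunE zcharD zcharN !zchar_sum exprMn exprVn.
  rewrite -!prodrXl; congr (_ / _); apply: eq_bigr => i _; rewrite zcharMn -exprM //.
  by rewrite zchar_lower_adj mulnC.
rewrite big_split /= prodfV [X in _ / X]exchange_big divff //.
by apply/prodf_neq0 => j _; apply/prodf_neq0 => i _; rewrite expf_neq0 ?zchar_neq0.
Qed.

Lemma lower_mapE M (i j : 'I_r) : (i < j)%N ->
  lower_map M (zbasis i) j = lower_entry M j i.
Proof.
move=> ij; rewrite !ffunE [X in _ - X]big1 ?subr0 => [|k _]; last first.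
  rewrite ffunE; case: eqP => [->|_]; last by rewrite mulr0n.
  by rewrite lower_adj_entry0 ?mul0rn // ltnW.
rewrite (bigD1 i) //= big1 ?addr0 => [|k /negPf ki]; last by rewrite ffunE ki mulr0n.
by rewrite ffunE eqxx val_inZp Zmod_mulrn_mod ?lower_entry_order // mulr1n.
Qed.

Lemma lower_map_inj : injective lower_map.
Proof.
move=> M M' E; apply/ffunP => j; apply/ffunP => i.
have ir : (i < r)%N by rewrite (ltn_trans (ltn_ord i)).
have entry (L : lower) : L j i = lower_entry L j (Ordinal ir).
  by rewrite /lower_entry /= valK.
have ij : (Ordinal ir < j)%N := ltn_ord i.
by rewrite !entry -!(lower_mapE _ ij) E.
Qed.

Lemma card_alternating : #|alt| = (\prod_(i < r) a i ^ i)%N.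
Proof.
have -> : alt = [set lower_map M | M in [set: lower]]%SET.
  apply/setP => phi; apply/idP/imsetP => [phiA|[M _ ->]]; last exact: lower_map_alternating.
  (* The entries of phi below the diagonal; by [alternating_ext] they determine it. *)
  pose M : lower := [ffun j : 'I_r => [ffun i : 'I_j =>
     phi (zbasis (widen_ord (ltnW (ltn_ord j)) i)) j : Zmod (a j)]].
  exists M; rewrite ?inE //; apply: alternating_ext => // [|i j ij].
    exact: lower_map_alternating.
  rewrite lower_mapE // /lower_entry (insubT (fun k => k < j)%N ij) !ffunE.
  by congr (phi (zbasis _) j); apply: val_inj.
rewrite (card_imset _ lower_map_inj) cardsT card_dep_ffun foldrE big_image /=.
apply: eq_bigr => j _.
by rewrite card_ffun !card_ord prednK.
Qed.

End ZmodSumPairing.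

(** * Surjections from the sandpile group as colorings *)

Lemma zmod_morphism0 (A B : zmodType) (f : A -> B) : zmod_morphism f -> f 0 = 0.
Proof. by move=> fB; rewrite -(subrr 0) fB subrr. Qed.

Section SandpileSurjections.
Variables (n : nat) (g : graph n.+1) (G : finZmodType).

(** Projecting along the first basis vector turns homomorphisms on zero-sum vectors into tuples of
    values in G that are 0 at the root [ord0]. *)
Definition zero_sum_retract (v : 'cV[int]_n.+1) : 'cV[int]_n.+1 :=
  v - (\sum_i v i 0) *: delta_mx 0 0.

Lemma zero_sum_retract_subproof v : zero_sum_retract v \in zero_sum.
Proof.
rewrite unfold_in; under eq_bigr do rewrite !mxE.
rewrite sumrB subr_eq0; apply/eqP.
rewrite [RHS](bigD1 ord0) //= mulr1 [X in _ + X]big1 ?addr0 // => i /negPf->.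
by rewrite mulr0.
Qed.

Lemma zero_sum_retract_id v : v \in zero_sum -> zero_sum_retract v = v.
Proof. by rewrite /zero_sum_retract => /eqP->; rewrite scale0r subr0. Qed.

Definition sandpile_class (v : 'cV[int]_n.+1) : sandpile g :=
  \pi_(sandpile g)%qT
    (exist (fun w => w \in zero_sum) _ (zero_sum_retract_subproof v) : zsum n.+1).

Lemma sandpile_class_morphism : zmod_morphism sandpile_class.
Proof.
move=> u v; rewrite /sandpile_class -raddfB; congr (\pi_(_)%qT _).
apply: val_inj; rewrite raddfB /= /zero_sum_retract.
under eq_bigr do rewrite !mxE.
by rewrite sumrB scalerBl !opprD addrACA.
Qed.

Lemma sandpile_class_val (z : zsum n.+1) :
  sandpile_class (val z) = \pi_(sandpile g)%qT z.
Proof.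
congr (\pi_(_)%qT _); apply: val_inj => /=.
exact/zero_sum_retract_id/valP.
Qed.

Lemma sandpile_class_repr x : sandpile_class (val (repr x)) = x.
Proof. by rewrite sandpile_class_val reprK. Qed.

Lemma pi_sandpile_eq (u v : zsum n.+1) :
  (\pi_(sandpile g)%qT u = \pi_(sandpile g)%qT v) <->
  exists w, val u - val v = laplacian g *m w.
Proof.
split=> [/eqP|[w uv]]; last apply/eqP; rewrite -Quotient.idealrBE unfold_in.
  by case/asboolP => w uv; exists w; rewrite -uv raddfB.
by apply/asboolP; exists w; rewrite raddfB.
Qed.

Lemma sandpile_class_eq0 v :
  (exists w, zero_sum_retract v = laplacian g *m w) -> sandpile_class v = 0.
Proof.
have -> : (0 : sandpile g) = \pi_(sandpile g)%qT 0 by rewrite raddf0.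
move=> [w vw]; apply/pi_sandpile_eq; exists w.
by rewrite [val 0]raddf0 subr0.
Qed.

Lemma sandpile_class_laplacian v : sandpile_class (laplacian g *m v) = 0.
Proof.
apply: sandpile_class_eq0; exists v.
by rewrite zero_sum_retract_id // laplacian_zero_sum.
Qed.

(** By [sum_laplacian] this means that [linear_ext c] kills every column of the Laplacian. *)
Definition balanced (c : {ffun 'I_n.+1 -> G}) : bool :=
  [forall j, \sum_i (c j - c i) *+ adj g i j == 0].

Definition colorings : {set {ffun 'I_n.+1 -> G}} :=
  [set c : {ffun 'I_n.+1 -> G} | generates_differences (c @: [set: 'I_n.+1])%SET && balanced c]%SET.

Definition rooted_colorings : {set {ffun 'I_n.+1 -> G}} :=
  [set c in colorings | c ord0 == 0]%SET.

Lemma sum_laplacian (c : {ffun 'I_n.+1 -> G}) j :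
  \sum_i c i *~ laplacian g i j = - \sum_i (c j - c i) *+ adj g i j.
Proof.
rewrite (bigD1 j) //= mxE eqxx mulrNz -sumrN.
rewrite [RHS](bigD1 j) //= subrr mul0rn oppr0 add0r.
have -> : c j *~ (degree g j)%:Z = \sum_(i | i != j) c j *+ adj g i j.
  rewrite /degree -sum1_card big_mkcond /= (bigD1 j) //= inE adj_irrefl add0n.
  rewrite -[_ *~ _]/(c j *+ _) -sumrMnr; apply: eq_bigr => i _.
  by rewrite inE adj_sym; case: (adj g i j).
rewrite -sumrN -big_split /=; apply: eq_bigr => i /negPf ij.
by rewrite mxE ij mulrnBl opprB addrC.
Qed.

Definition linear_ext (c : {ffun 'I_n.+1 -> G}) (v : 'cV[int]_n.+1) : G :=
  \sum_i c i *~ v i 0.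

Lemma linear_ext_morphism c : zmod_morphism (linear_ext c).
Proof.
move=> u v; rewrite /linear_ext -sumrB; apply: eq_bigr => i _.
by rewrite !mxE mulrzBr.
Qed.

Lemma linear_ext_laplacian c v : balanced c -> linear_ext c (laplacian g *m v) = 0.
Proof.
move=> /'forall_eqP bal; rewrite /linear_ext.
under eq_bigr do rewrite mxE mulrz_sumr.
rewrite exchange_big big1 //= => j _.
under eq_bigr do rewrite mulrzA.
by rewrite -mulrz_suml sum_laplacian bal oppr0 mul0rz.
Qed.

Definition sandpile_map (c : {ffun 'I_n.+1 -> G}) (x : sandpile g) : G :=
  linear_ext c (val (repr x)).

Definition coloring_of (f : sandpile g -> G) : {ffun 'I_n.+1 -> G} :=
  [ffun i => f (sandpile_class (delta_mx i 0))].

Lemma linear_ext_coloring_of f v : zmod_morphism f ->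
  linear_ext (coloring_of f) v = f (sandpile_class v).
Proof.
move=> fB; have fcB : zmod_morphism (f \o sandpile_class).
  by move=> x y; rewrite /= sandpile_class_morphism fB.
rewrite -[RHS]/((f \o sandpile_class) v) (zmod_morphism_cV v fcB).
by apply: eq_bigr => i _; rewrite ffunE.
Qed.

Lemma coloring_ofK f : zmod_morphism f -> sandpile_map (coloring_of f) = f.
Proof.
move=> fB; apply/funext => x.
by rewrite /sandpile_map linear_ext_coloring_of // sandpile_class_repr.
Qed.

Lemma linear_ext_delta c i : linear_ext c (delta_mx i 0) = c i.
Proof.
rewrite /linear_ext (bigD1 i) //= mxE !eqxx big1 ?addr0 // => j /negPf ji.
by rewrite mxE ji.
Qed.

(** The chosen representative of the class differs from the retract of v by an element of the
    Laplacian image, which a balanced c kills; the retraction subtracts a multiple of the root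
    vector, where c is 0. *)
Lemma sandpile_map_class c v : balanced c -> c ord0 = 0 ->
  sandpile_map c (sandpile_class v) = linear_ext c v.
Proof.
move=> bal c0.
have linB := linear_ext_morphism c.
have lin_retract : linear_ext c (zero_sum_retract v) = linear_ext c v.
  rewrite /zero_sum_retract linB.
  suff -> : linear_ext c ((\sum_i v i 0) *: delta_mx 0 0) = 0 by rewrite subr0.
  rewrite /linear_ext big1 // => i _; rewrite !mxE eqxx andbT.
  by case: eqP => [->|_]; rewrite ?c0 ?mul0rz // mulr0 mulr0z.
have /pi_sandpile_eq[w] : \pi_(sandpile g)%qT (repr (sandpile_class v)) =
    \pi_(sandpile g)%qT
      (exist (fun w => w \in zero_sum) _ (zero_sum_retract_subproof v) : zsum n.+1).
  by rewrite reprK.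
move=> /(congr1 (linear_ext c)); rewrite linB linear_ext_laplacian // => /eqP.
by rewrite subr_eq0 => /eqP; rewrite lin_retract.
Qed.

Lemma sandpile_map_morphism c : balanced c -> c ord0 = 0 -> zmod_morphism (sandpile_map c).
Proof.
move=> bal c0 x y; rewrite -[x]sandpile_class_repr -[y]sandpile_class_repr.
by rewrite -sandpile_class_morphism !sandpile_map_class // linear_ext_morphism.
Qed.

Lemma sandpile_mapK c : balanced c -> c ord0 = 0 -> coloring_of (sandpile_map c) = c.
Proof.
by move=> bal c0; apply/ffunP => i; rewrite ffunE sandpile_map_class // linear_ext_delta.
Qed.

Lemma coloring_of0 f : zmod_morphism f -> coloring_of f ord0 = 0.
Proof.
move=> fB; rewrite ffunE.
have -> : sandpile_class (delta_mx 0 0) = 0.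
  apply: sandpile_class_eq0; exists 0; rewrite mulmx0.
  rewrite /zero_sum_retract (bigD1 ord0) //= mxE !eqxx big1 ?addr0 ?scale1r ?subrr //.
  by move=> i /negPf i0; rewrite mxE i0.
exact: zmod_morphism0.
Qed.

Lemma coloring_of_balanced f : zmod_morphism f -> balanced (coloring_of f).
Proof.
move=> fB; apply/'forall_eqP => j; apply: oppr_inj.
rewrite -sum_laplacian oppr0.
have := linear_ext_coloring_of (laplacian g *m delta_mx j 0) fB.
rewrite sandpile_class_laplacian zmod_morphism0 //; apply: etrans.
apply: eq_bigr => i _; congr (_ *~ _).
rewrite [RHS]mxE (bigD1 j) //= [delta_mx _ _ _ _]mxE !eqxx mulr1 big1 ?addr0 // => k /negPf kj.
by rewrite [delta_mx _ _ _ _]mxE kj mulr0.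
Qed.

(** The values of f are the integer combinations of the colors. Since the root has color 0, colors
    are themselves differences, so the differences generate the range of f. *)
Lemma generates_coloring_of f : zmod_morphism f ->
  generates_differences (coloring_of f @: [set: 'I_n.+1])%SET <-> range f = [set: G].
Proof.
move=> fB; split => [/asboolP gen|fT].
  pose K := [set y | `[< exists x, f x = y >]]%SET.
  have KP y : reflect (exists x, f x = y) (y \in K) by rewrite finset.in_set; exact: asboolP.
  have KT : K = [set: G]%SET.
    apply: gen; first split.
    - by apply/KP; exists 0; exact: zmod_morphism0.
    - by move=> u v /KP[x <-] /KP[y <-]; apply/KP; exists (x - y); rewrite fB.
    by move=> _ _ /imsetP[i _ ->] /imsetP[j _ ->]; apply/KP; rewrite !ffunE -fB; eexists.
  apply/seteqP; split => // y _.
  by have /KP[x <-] : y \in K; [rewrite KT finset.in_setT | exists x].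
apply/asboolP => K [K0 KB] Kc; apply/setP => y; rewrite [RHS]inE.
have KN u : u \in K -> - u \in K by move=> uK; rewrite -sub0r; exact: KB.
have KD u v : u \in K -> v \in K -> u + v \in K.
  by move=> uK vK; rewrite -[v]opprK; apply: KB => //; exact: KN.
have KMn u k : u \in K -> u *+ k \in K.
  by move=> uK; elim: k => [|k IHk]; rewrite ?mulr0n // mulrS KD.
have KMz u (k : int) : u \in K -> u *~ k \in K.
  move=> uK; case: k => k; first exact: KMn.
  by rewrite NegzE mulrNz KN //; exact: KMn.
have [x _ <-] : range f y by rewrite fT.
rewrite -[f x](congr1 f (sandpile_class_repr x)) -linear_ext_coloring_of //.
rewrite /linear_ext; elim/big_ind: _ => // i _; apply: KMz.
by rewrite -[coloring_of f i]subr0 -(coloring_of0 fB) Kc ?imset_f ?inE.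
Qed.

Lemma Sur_sandpileE : Sur (sandpile g) G = sandpile_map @` [set` rooted_colorings].
Proof.
apply/seteqP; split => [f [fB fT]|_ [c + <-]].
  exists (coloring_of f); last exact: coloring_ofK.
  rewrite /= !inE coloring_of0 // eqxx andbT coloring_of_balanced // andbT.
  exact/generates_coloring_of.
rewrite /= !inE => /andP[/andP[cgen cbal] /eqP c0].
have cB := sandpile_map_morphism cbal c0.
by split => //; apply/(generates_coloring_of cB); rewrite sandpile_mapK.
Qed.

Lemma num_Sur_rooted : num_Sur (sandpile g) G = #|rooted_colorings|.
Proof.
rewrite /num_Sur cardE -(size_map sandpile_map); apply/perm_size/uniq_perm.
- exact: fset_uniq.
- rewrite map_inj_in_uniq ?enum_uniq // => c c'.
  rewrite !mem_enum !inE => /andP[/andP[_ cb] /eqP c0] /andP[/andP[_ cb'] /eqP c0'] E.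
  by rewrite -(sandpile_mapK cb c0) E sandpile_mapK.
move=> f; rewrite Sur_sandpileE in_fset_set; last exact/finite_image/finite_finset.
apply/idP/mapP => [|[c cS ->]].
  by rewrite inE => -[c cS <-]; exists c => //; rewrite mem_enum.
by rewrite inE /=; exists c => //; rewrite mem_enum in cS.
Qed.

Definition translate (p : G * {ffun 'I_n.+1 -> G}) : {ffun 'I_n.+1 -> G} :=
  [ffun i => p.2 i + p.1].

Lemma translate_colorings t c :
  (translate (t, c) \in colorings) = (c \in colorings).
Proof.
rewrite !inE; congr (_ && _); last first.
  by apply: eq_forallb => j; under eq_bigr do rewrite !ffunE opprD addrACA subrr addr0.
apply: asbool_equiv_eq; split => gen K Kz Kc; apply: gen => // _ _ /imsetP[i _ ->] /imsetP[j _ ->].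
  rewrite !ffunE opprD addrACA subrr addr0.
  by apply: Kc; rewrite imset_f ?inE.
rewrite (_ : c i - c j = translate (t, c) i - translate (t, c) j).
  by apply: Kc; rewrite imset_f ?inE.
by rewrite !ffunE opprD addrACA subrr addr0.
Qed.

(** Both conditions on a coloring involve differences only, so G acts freely by translation, and
    each orbit has exactly one coloring with color 0 at the root. *)
Lemma card_colorings : #|colorings| = (#|G| * num_Sur (sandpile g) G)%N.
Proof.
rewrite num_Sur_rooted -[X in (X * _)%N]cardsT -finset.cardsX.
have inj : {in finset.setX [set: G] rooted_colorings &, injective translate}.
  move=> [t c] [t' c'] /finset.setXP[_ +] /finset.setXP[_ +] E.
  rewrite !inE => /andP[_ /eqP c0] /andP[_ /eqP c0'].
  have tE : t = t'.
    by have /ffunP/(_ ord0) := E; rewrite !ffunE /= c0 c0' !add0r.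
  rewrite tE; congr pair; apply/ffunP => i.
  by have /ffunP/(_ i) := E; rewrite !ffunE /= tE => /addIr.
rewrite -(card_in_imset inj); apply: eq_card => c; apply/idP/imsetP.
  move=> cC; exists (c ord0, translate (- c ord0, c)).
    rewrite finset.in_setX finset.in_setT /= finset.in_set translate_colorings cC.
    by rewrite ffunE /= subrr eqxx.
  by apply/ffunP => i; rewrite !ffunE /= subrK.
move=> [[t c']]; rewrite finset.in_setX => /andP[_ +] ->.
by rewrite finset.in_set translate_colorings => /andP[].
Qed.

End SandpileSurjections.

(** * Fourier expansion of the expectation *)

Lemma prim_root_exists (C : numClosedFieldType) n :
  (0 < n)%N -> exists z : C, n.-primitive_root z.
Proof.
pose p : {poly C} := 'X^n - 1; have [s Dp] := closed_field_poly_normal p => n_gt0.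
rewrite (monicP _) ?monicXnsubC // scale1r in Dp.
have sn1 : all n.-unity_root s by apply/allP => z; rewrite -root_prod_XsubC -Dp.
have sz_s : (n < (size s).+1)%N by rewrite -(size_prod_XsubC s id) -Dp size_XnsubC.
have [|z] := hasP (cyclic.has_prim_root n_gt0 sn1 _ sz_s); last by exists z.
by rewrite -separable_prod_XsubC -Dp separable_Xn_sub_1 // pnatr_eq0 -lt0n.
Qed.

(** Equality in the triangle inequality would make [1 - q] and [q * z] positive multiples of the
    same unit number, forcing z = 1. *)
Lemma norm_convex_lt1 (C : numClosedFieldType) (q z : C) :
  0 < q -> q < 1 -> `|z| = 1 -> z != 1 -> `|1 - q + q * z| < 1.
Proof.
move=> q0 q1 z1 zn1.
have q1' : 0 < 1 - q by rewrite subr_gt0.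
have n1 : `|1 - q| = 1 - q by rewrite gtr0_norm.
have n2 : `|q * z| = q by rewrite normrM z1 mulr1 gtr0_norm.
rewrite lt_neqAle; apply/andP; split; last first.
  by apply: le_trans (ler_normD _ _) _; rewrite n1 n2 subrK.
apply: contraNneq zn1 => E.
have [|t _] := @normCDeq _ (1 - q) (q * z); first by rewrite E n1 n2 subrK.
rewrite n1 n2 => -[/esym/eqP]; rewrite -subr_eq0 -{2}[1 - q]mulr1 -mulrBr mulf_eq0.
rewrite (gt_eqF q1') /= subr_eq0 => /eqP->.
by rewrite mulr1 => /eqP; rewrite -subr_eq0 -{2}[q]mulr1 -mulrBr mulf_eq0 (gt_eqF q0) /= subr_eq0.
Qed.

Section Fourier.
Variable R : realType.
Local Notation "x %:C" := (real_complex R x) : ring_scope.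
Variables (G : finZmodType) (b : G -> G -> R[i]).
Hypothesis bP : perfect_pairing b.
Variables (q : R) (hq : 0 < q < 1).

(** Finitely many moduli below 1 have a maximum below 1; its default 0 covers the case where no pair
    is incompatible. *)
Lemma edge_weight_gap : exists2 rho : R, 0 <= rho < 1 &
  forall x y, b x y != 1 -> `|(1 - q)%:C + q%:C * b x y| <= rho%:C.
Proof.
pose u (p : G * G) : R := complex.Re `|(1 - q)%:C + q%:C * b p.1 p.2|.
have uE p : (u p)%:C = `|(1 - q)%:C + q%:C * b p.1 p.2| by exact/RRe_real/normr_real.
exists (\big[Num.max/0]_(p | b p.1 p.2 != 1) u p).
  rewrite bigmax_ge_id /=; apply: bigmax_lt => // p p1.
  rewrite -ltcR uE rmorphB rmorph1; have /andP[q0 q1] := hq.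
  by apply: norm_convex_lt1; rewrite ?ltcR ?(pairing_norm bP).
by move=> x y xy; rewrite -(uE (x, y)) lecR; exact: (le_bigmax_cond 0 _ (j := (x, y))).
Qed.

Section Edges.
Variable n : nat.

(** The product runs over ordered pairs of endpoints because an edge has no orientation; the pairs
    with i = j contribute 1. *)
Definition edge_char (f : {ffun 'I_n -> G * G}) (e : edge n) : R[i] :=
  \prod_(i in val e) \prod_(j in val e) b (f j).2 ((f j).1 - (f i).1).

Definition edge_weight (f : {ffun 'I_n -> G * G}) (e : edge n) : R[i] :=
  (1 - q)%:C + q%:C * edge_char f e.

Lemma edge_charE f e i j : i != j -> val e = [set i; j]%SET ->
  edge_char f e = b ((f i).2 - (f j).2) ((f i).1 - (f j).1).
Proof.
move=> ij ve; rewrite /edge_char ve.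
have pr (F : 'I_n -> R[i]) : \prod_(k in [set i; j]%SET) F k = F i * F j.
  by rewrite big_setU1 ?inE // big_set1.
rewrite !pr !subrr !(pairing0r bP) mul1r mulr1 (pairingBl bP).
by rewrite -[(f j).1 - (f i).1]opprB (pairingNr bP) mulrC.
Qed.

Lemma edge_weight_conflict rho f e :
  (forall x y, b x y != 1 -> `|(1 - q)%:C + q%:C * b x y| <= rho%:C) ->
  conflict (compatible b) f e -> `|edge_weight f e| <= rho%:C.
Proof.
move=> hrho /exists_inP[i ie /exists_inP[j je ij]].
have ij' : i != j by apply: contraNneq ij => ->; exact: compatible_refl bP _.
have ve : val e = [set i; j]%SET.
  apply/esym/eqP; rewrite finset.eqEcard cards2 ij' (eqP (valP e)) andbT.
  by apply/fintype.subsetP => k; rewrite !inE => /orP[] /eqP->.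
by rewrite /edge_weight (edge_charE f ij' ve); exact: hrho.
Qed.

Lemma edge_weight_comp f e : ~~ conflict (compatible b) f e -> edge_weight f e = 1.
Proof.
have /cards2P[i [j [ij ve]]] := valP e.
move=> /exists_inP nc; have /eqP h : compatible b (f i) (f j).
  apply/negPn/negP => fij; apply: nc; exists i; first by rewrite ve !inE eqxx.
  by apply/exists_inP; exists j => //; rewrite ve !inE eqxx orbT.
by rewrite /edge_weight (edge_charE f ij ve) h mulr1 -rmorphD subrK.
Qed.

Lemma prod_edges (g : graph n) (F : 'I_n -> 'I_n -> R[i]) :
  (forall i, F i i = 1) ->
  \prod_(e in g) \prod_(i in val e) \prod_(j in val e) F i j
  = \prod_j \prod_i F i j ^+ adj g i j.
Proof.
move=> F1.
transitivity (\prod_(e in g) \prod_i \prod_j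
    (if (i \in val e) && (j \in val e) then F i j else 1)).
  apply: eq_bigr => e _; rewrite big_mkcond; apply: eq_bigr => i _.
  by case: (i \in val e); [rewrite big_mkcond | rewrite [RHS]big1].
rewrite exchange_big [RHS]exchange_big; apply: eq_bigr => i _ /=.
rewrite exchange_big; apply: eq_bigr => j _ /=.
have [->|ij] := eqVneq i j.
  by rewrite F1 expr1n big1 // => e _; case: ifP.
have mem_e (e : edge n) : (i \in val e) && (j \in val e) = (val e == [set i; j]%SET).
  apply/andP/eqP => [[ie je]|->]; last by rewrite !inE !eqxx orbT.
  apply/esym/eqP; rewrite finset.eqEcard cards2 ij (eqP (valP e)) andbT.
  by apply/fintype.subsetP => k; rewrite !inE => /orP[] /eqP->.
under eq_bigr do rewrite mem_e.
rewrite -big_mkcondr /adj; case: exists_inP => [[e eg /eqP ve]|none] /=.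
  rewrite (big_pred1 e) // => e' /=.
  apply/andP/eqP => [[_ /eqP]|->]; last by rewrite eg -ve eqxx.
  by rewrite -ve => ee; exact: val_inj.
by rewrite big1 // => e /andP[eg ve]; case: none; exists e.
Qed.

Lemma balanced_chars (g : graph n) (c y : {ffun 'I_n -> G}) :
  \prod_j b (y j) (\sum_i (c j - c i) *+ adj g i j)
  = \prod_(e in g) edge_char [ffun i => (c i, y i)] e.
Proof.
rewrite (@prod_edges g (fun i j => b ([ffun i => (c i, y i)] j).2
  (([ffun i => (c i, y i)] j).1 - ([ffun i => (c i, y i)] i).1))) => [|i].
  apply: eq_bigr => j _; rewrite (pairing_sumr bP); apply: eq_bigr => i _.
  by rewrite (pairingMnr bP) !ffunE.
by rewrite subrr (pairing0r bP).
Qed.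

(** Edges are independent: expanding the product on the right chooses the set of present edges, that
    is, a graph with its probability. *)
Lemma expectation_edge_chars (f : {ffun 'I_n -> G * G}) :
  \sum_(g : graph n) (gnq_prob q g)%:C * \prod_(e in g) edge_char f e
  = \prod_e edge_weight f e.
Proof.
rewrite /edge_weight; under [RHS]eq_bigr do rewrite addrC.
rewrite bigA_distr; apply: eq_bigr => g _.
rewrite /gnq_prob rmorph_prod [X in _ * X]big_mkcond -big_split /=.
by apply: eq_bigr => e _; case: ifP; rewrite ?mulr1.
Qed.

End Edges.

Definition generating (S : {set G * G}) : bool :=
  generates_differences (fst @: S : {set G}).

(** Orthogonality at each vertex j, with dual variable y j, detects the j-th equation and yields one
    factor |G|. *)
Lemma balanced_fourier n (g : graph n.+1) (c : {ffun 'I_n.+1 -> G}) :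
  (balanced g c)%:R * (#|G| ^ n.+1)%:R
  = \sum_(y : {ffun 'I_n.+1 -> G})
      \prod_(e in g) edge_char [ffun i => (c i, y i)] e.
Proof.
under eq_bigr do rewrite -balanced_chars.
rewrite -(bigA_distr_bigA (fun j u => b u (\sum_i (c j - c i) *+ adj g i j))) /=.
under [RHS]eq_bigr do rewrite (pairing_orthogonality bP).
rewrite big_split /= prodr_const card_ord natrX; congr (_ * _).
have [/'forall_eqP bal|] := boolP (balanced g c).
  by rewrite big1 // => j _; rewrite bal eqxx.
rewrite negb_forall => /existsP[j /negPf bj].
by rewrite (bigD1 j) //= bj mul0r.
Qed.

Lemma expectation_colorings n :
  (gnq_expectation q (fun g : graph n.+1 => #|colorings g G|%:R))%:C
    * (#|G| ^ n.+1)%:R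
  = \sum_(f : {ffun 'I_n.+1 -> G * G} | generating (f @: [set: 'I_n.+1])%SET)
      \prod_e edge_weight f e.
Proof.
pose pr (p : {ffun 'I_n.+1 -> G} * {ffun 'I_n.+1 -> G}) :
  {ffun 'I_n.+1 -> G * G} := [ffun i => (p.1 i, p.2 i)].
pose un (f : {ffun 'I_n.+1 -> G * G}) := ([ffun i => (f i).1], [ffun i => (f i).2]).
have pr_bij : bijective pr.
  exists un => [[c y]|f]; last by apply/ffunP => i; rewrite !ffunE; case: (f i).
  by congr pair; apply/ffunP => i; rewrite !ffunE.
rewrite (reindex pr) /=; last exact: onW_bij.
have genE c y : generating (pr (c, y) @: [set: 'I_n.+1])%SET
    = generates_differences (c @: [set: 'I_n.+1])%SET.
  rewrite /generating -imset_comp; congr generates_differences.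
  by apply: eq_imset => i; rewrite /= ffunE.
rewrite (eq_bigl (fun p : {ffun 'I_n.+1 -> G} * {ffun 'I_n.+1 -> G} =>
    generates_differences (p.1 @: [set: 'I_n.+1])%SET)); last first.
  by case=> c y; rewrite genE.
under [RHS]eq_bigr do rewrite -expectation_edge_chars.
rewrite exchange_big /gnq_expectation rmorph_sum mulr_suml; apply: eq_bigr => g _ /=.
rewrite -mulr_sumr rmorphM rmorph_nat -mulrA; congr (_ * _).
transitivity (\sum_(c : {ffun 'I_n.+1 -> G} | generates_differences (c @: [set: 'I_n.+1])%SET)
    \sum_(y : {ffun 'I_n.+1 -> G}) \prod_(e in g) edge_char (pr (c, y)) e); last first.
  by rewrite pair_big; apply: eq_big => [p|[c y]]; rewrite ?andbT.
under eq_bigr do rewrite -balanced_fourier.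
rewrite -mulr_suml; congr (_ * _); rewrite -sum1_card natr_sum.
rewrite big_mkcond [RHS]big_mkcond /=; apply: eq_bigr => c _.
by rewrite inE; case: (generates_differences _); case: (balanced _ _).
Qed.

(** The estimate for colorings is divided by |G| for each vertex, from Fourier inversion, and once
    more by |G| for the translates of rooted colorings. The latter cancels the factor |G| in
    [card_lagrangians]. *)
Lemma expectation_num_Sur_bound : exists K theta : R, [/\ 0 <= K, 0 <= theta < 1 &
  forall n, `|gnq_expectation q
      (fun g : graph n.+1 => (num_Sur (sandpile g) G)%:R) - #|alternating b|%:R|
    <= K * theta ^+ n.+1].
Proof.
have G0 : (0 < #|G|)%N by apply/card_gt0P; exists 0.
have [rho /andP[rho0 rho1] hrho] := edge_weight_gap.
have [K [theta [K0 /andP[th0 thG] hK]]] := clique_sum_asymptotics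
  (compatible_sym bP) (compatible_refl bP) G0 (@clique_card_le _ _ _ bP)
  generating rho0 rho1 (0 : G * G).
have GR : 0 < #|G|%:R :> R by rewrite ltr0n.
exists (K / #|G|%:R), (theta / #|G|%:R); split.
- by rewrite divr_ge0.
- by rewrite divr_ge0 //= ltr_pdivrMr // mul1r.
move=> n; have := hK n.+1 (@edge_weight n.+1).
move=> /(_ (fun f e => edge_weight_conflict hrho) (fun f e => @edge_weight_comp _ f e)).
rewrite -expectation_colorings -[max_cliques _ _ _]/(lagrangians b) card_lagrangians //.
set E := gnq_expectation q _; set E' := gnq_expectation q _.
have -> : E = #|G|%:R * E'.
  rewrite /E /E' /gnq_expectation mulr_sumr; apply: eq_bigr => g _.
  by rewrite card_colorings natrM mulrCA.
rewrite -!(rmorph_nat (real_complex R)) -rmorphM -rmorphB /=.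
rewrite normc_def /= expr0n /= addr0 sqrtr_sqr lecR.
rewrite !natrM natrX => h.
have GX : 0 < #|G|%:R ^+ n.+1 :> R by rewrite exprn_gt0.
rewrite expr_div_n mulf_div ler_pdivlMr ?mulr_gt0 //; apply: le_trans h.
rewrite [X in _ <= `| X | ](_ : _ =
  (E' - #|alternating b|%:R) * (#|G|%:R * #|G|%:R ^+ n.+1)); last by ring.
by rewrite normrM ler_wpM2l // ler_norm.
Qed.

End Fourier.

(* The index i : 'I_r counts from 0, so the exponent i below is the usual
   i - 1, and the divisibility chain reads a (r-1) | ... | a 1 | a 0. *)
Theorem theorem1p2 (R : realType) (q : R) (hq : 0 < q < 1)
    (r : nat) (a : 'I_r -> nat)
    (a_gt0 : forall i : 'I_r, (0 < a i)%N)
    (a_dvd : forall i j : 'I_r, (i <= j)%N -> (a j %| a i)%N) :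
  (fun n : nat => gnq_expectation q
     (fun g : graph n => (num_Sur (sandpile g) (Zmod_sum a))%:R : R)) @ \oo
    --> ((\prod_(i < r) a i ^ i)%N%:R : R).
Proof.
pose m := (\prod_i a i)%N.
have m_gt0 : (0 < m)%N by rewrite prodn_gt0.
have [z z_prim] := prim_root_exists R[i]%C m_gt0.
have a_dvd_m i : (a i %| m)%N by rewrite /m (bigD1 i) //= dvdn_mulr.
have bP := zpairingP a_gt0 z_prim a_dvd_m.
have [K [theta [K0 /andP[th0 th1] hK]]] := expectation_num_Sur_bound bP hq.
rewrite -(card_alternating a_gt0 z_prim a_dvd_m a_dvd).
have /cvgr0Pnorm_le K0' : geometric K theta @ \oo --> (0 : R).
  by apply: cvg_geometric; rewrite ger0_norm.
(* The bound concerns graphs on n + 1 vertices; starting at [N.+1] discards the empty vertex set. *)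
apply/cvgrPdist_le => e /K0'[N _ hN]; exists N.+1 => // -[//|n] Nn /=.
rewrite distrC; apply: le_trans (hK n) (le_trans (ler_norm _) (hN n.+1 _)).
exact: ltnW.
Qed.
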